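(* Let $d>0$, $a\in[0,1)$, and $$c^*=\inf_{\lambda>0}\frac{\ln\left((1+d)\int_{\mathbb R}e^{\lambda y}k(y)\,dy\right)}{\lambda}.$$ If $c=c^*$, then the equation $$w_{n+1}(x)=\int_{\mathbb R}\frac{(1+d)w_n(x-y)}{1+d\big(w_n(x-y)+a\,w_{n-1}(x-y)\big)}k(y)\,dy,\qquad x\in\mathbb R,\ n=0,1,2,\dots,$$ has a traveling wave solution $w_n(x)=\phi(\xi)$, $\xi=x+cn$, satisfying $$0<\phi(\xi)\le1\ (\xi\in\mathbb R),\qquad\lim_{\xi\to-\infty}\phi(\xi)=0,\qquad\lim_{\xi\to+\infty}\phi(\xi)=\frac1{1+a}.$$
   Context: The kernel $k:\mathbb R\to[0,\infty)$ is Lebesgue measurable and integrable, even ($k(x)=k(-x)$), with $\int_{\mathbb R}k(y)\,dy=1$ and $\int_{\mathbb R}k(y)e^{\lambda y}dy<\infty$ for every $\lambda\ge0$. A traveling wave solution with speed $c>0$ is a solution of the form $w_n(x)=\phi(x+cn)$ with $\phi:\mathbb R\to\mathbb R$ bounded and uniformly continuous; equivalently $$\phi(\xi+c)=\int_{\mathbb R}\frac{(1+d)\phi(\xi-y)}{1+d(\phi(\xi-y)+a\phi(\xi-y-c))}k(y)\,dy\quad\text{for all }\xi\in\mathbb R.$$ *)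

(* Defs.v *)
From HB Require Import structures.
From mathcomp Require Import all_boot all_order all_algebra.
From mathcomp Require Import all_classical all_reals all_analysis.
Set Implicit Arguments.
Unset Strict Implicit.
Unset Printing Implicit Defensive.
Import Order.TTheory GRing.Theory Num.Theory.
Import numFieldNormedType.Exports.
Local Open Scope classical_set_scope.
Local Open Scope ring_scope.

(* The kernel is only assumed Lebesgue measurable, so every integral is taken
   with respect to the completed Lebesgue measure: its sigma-algebra is the
   Lebesgue one, whereas that of [lebesgue_measure] is the Borel one. *)
Notation leb R := (@completed_lebesgue_measure R).

(* [integrable] includes measurability. *)
Record dispersal_kernel (R : realType) (k : R -> R) : Prop := {
  kernel_ge0 : forall x, 0 <= k x ;
  kernel_integrable : (leb R).-integrable setT (EFin \o k) ;
  kernel_even : forall x, k x = k (- x) ;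
  kernel_mass1 : (\int[leb R]_y (k y)%:E = 1)%E ;
  kernel_exp_moment : forall l : R, 0 <= l ->
    (\int[leb R]_y (k y * expR (l * y))%:E < +oo)%E
}.

Definition cstar (R : realType) (d : R) (k : R -> R) : R :=
  inf [set ln ((1 + d) * \int[leb R]_y (expR (l * y) * k y)) / l
      | l in [set l : R | 0 < l]].

Definition growth_integrand (R : realType) (d a : R) (k u v : R -> R)
    (x y : R) : R :=
  (1 + d) * u (x - y) / (1 + d * (u (x - y) + a * v (x - y))) * k y.

(* The sequence is indexed by [int] because the equation at [n = 0] involves
   [w (-1)]; only the indices [n >= -1] are constrained.  [Rintegral] is total,
   hence the explicit integrability requirement. *)
Definition is_solution (R : realType) (d a : R) (k : R -> R)
    (w : int -> R -> R) : Prop :=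
  forall (n : int) (x : R), 0 <= n ->
    (leb R).-integrable setT
      (EFin \o growth_integrand d a k (w n) (w (n - 1)) x) /\
    w (n + 1) x =
      \int[leb R]_y growth_integrand d a k (w n) (w (n - 1)) x y.

Definition is_traveling_wave (R : realType) (d a : R) (k : R -> R) (c : R)
    (phi : R -> R) : Prop :=
  [/\ 0 < c, bounded_fun phi, unif_continuous phi &
      is_solution d a k (fun (n : int) (x : R) => phi (x + c * n%:~R))].

(* Main.v *)
Require Import Defs.
From HB Require Import structures.
From mathcomp Require Import all_boot all_order all_algebra.
From mathcomp Require Import all_classical all_reals all_analysis.
From mathcomp Require Import measurable_realfun.
From mathcomp Require Import ring lra.
Set Implicit Arguments.
Unset Strict Implicit.
Unset Printing Implicit Defensive.
Import Order.TTheory GRing.Theory Num.Theory.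
Import numFieldNormedType.Exports.
Local Open Scope classical_set_scope.
Local Open Scope ring_scope.

(** Substituting [phi (x + c n)] turns the recursion into the fixed-point
    equation [phi = T (phi, phi)], where [T (u, v)] at [x] is the mean, over the
    kernel, of [(1 + d) u / (1 + d (u + a v'))] at [x - c - y], and [v'] is [v]
    delayed by [c].  [T] increases in [u] and decreases in [v], and it lies
    below the linearization at zero, [L u (x) = (1 + d) E (u (x - c - Y))], where
    [Y] has density [k].

    The infimum defining the critical speed is attained at some [lam > 0]
    ([critical_exponent]).  At the minimum, [exp (lam x)] is fixed by [L], and
    the first-order condition says that the kernel tilted by [exp (lam y)] has
    mean [c], so that [x exp (lam x)] is fixed by [L] as well.  The second-order
    condition, which is strict because the kernel has no atoms, says that
    [exp (m x)] is strictly enlarged by [L] for [m > lam].  Hence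
    [(A - x) exp (lam x)], corrected by multiples of [exp (3 lam x / 2)] and
    [exp (2 lam x)], gives a super- and a subsolution
    ([super_solution], [sandwich]); both behave like [- x exp (lam x)] at minus
    infinity, and they differ by at most a multiple of [exp (lam x)].

    Compactness and a topological fixed-point theorem are replaced by
    monotonicity and a Liouville theorem.  The coupled iteration
    [u := T (u, l)], [l := T (l, u)], started from the super- and the
    subsolution, decreases in [u] and increases in [l].  The gap between the two
    limits is bounded by [1] and by a multiple of [exp (lam x)], and it is
    essentially a subsolution of [L], because the partial derivatives of the
    growth function have absolute values adding up to at most [1 + d]
    ([growth_diff]).  Such a subsolution vanishes ([liouville]): after division
    by [exp (lam x)] it is bounded and subharmonic for a mean-zero random walk,
    and it tends to zero at plus infinity.  So the two limits agree
    ([coupled_unique]); the common limit, being both an infimum and a supremum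
    of continuous functions, is continuous ([fixed_point]).

    The supersolution gives the limit at minus infinity.  At plus infinity the
    wave is bounded below, because in the rest frame a small compactly supported
    bump is a stationary subsolution ([persistence]; symmetry of the kernel
    enters there).  Finally, the lower limit [i] and the upper limit [s] at plus
    infinity satisfy [s + a i <= 1 <= i + a s], which forces
    [i = s = 1 / (1 + a)] ([limit_pinfty]). *)

Notation lebT R := (caratheodory_type (@wlength R idfun)^*%mu).

(** * Reflection invariance of the completed Lebesgue measure *)

Section Reflection.
Variable R : realType.

Lemma borel_leb_measurable (A : set R) :
  measurable A -> @measurable _ (lebT R) A.
Proof. by move=> mA; apply: sub_caratheodory. Qed.

Lemma borel_leb_measurable_fun (g : R -> R) : measurable_fun setT g ->
  measurable_fun (setT : set (lebT R)) g.
Proof. by move=> mg mT Y mY; apply: borel_leb_measurable; exact: mg. Qed.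

Lemma preimage_oppr_itv_oc (a b : R) : -%R @^-1` `]a, b] = `[- b, - a[%classic.
Proof.
by apply/seteqP; split=> x /=; rewrite !in_itv/= => /andP[? ?]; apply/andP; split; lra.
Qed.

(** A cover of [A] by half-open intervals reflects to intervals open on the other
    side; these are not covers in the same family, but they have the same
    measure, and outer measures are subadditive. *)
Lemma leb_oppr_le (A : set R) : (leb R (-%R @^-1` A) <= leb R A)%E.
Proof.
apply: le_ereal_inf_tmp => _ [F [mF AF] <-].
apply: (@le_trans _ _ (leb R (\bigcup_k (-%R @^-1` (F k))))).
  by apply: le_outer_measure => x /AF [k _ Fk]; exists k.
apply: (le_trans (outer_measure_sigma_subadditive (@wlength R idfun)^*%mu _)).
apply: lee_nneseries => // k _.
have [[a b] _ <-] := mF k; rewrite preimage_oppr_itv_oc.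
rewrite -[leLHS]/(@lebesgue_measure R _) lebesgue_measure_itv/= wlength_itv/=.
rewrite !lte_fin ltrN2; case: ifP => // _.
by rewrite -!EFinD lee_fin; lra.
Qed.

Lemma leb_oppr (A : set R) : leb R (-%R @^-1` A) = leb R A.
Proof.
apply/eqP; rewrite eq_le leb_oppr_le/=.
have := leb_oppr_le (-%R @^-1` A); rewrite (_ : -%R @^-1` _ = A)//.
by apply/seteqP; split=> x /=; rewrite opprK.
Qed.

Lemma measurable_oppr_leb (A : set R) :
  @measurable _ (lebT R) A -> @measurable _ (lebT R) (-%R @^-1` A).
Proof.
move=> mA; suff : caratheodory_measurable (@completed_lebesgue_measure R)
  (-%R @^-1` A) by [].
move=> X; have cA Y : leb R Y = (leb R (Y `&` A) + leb R (Y `&` ~` A))%E := mA Y.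
rewrite -leb_oppr cA -leb_oppr -[X in (_ + X)%E]leb_oppr.
by congr (leb R _ + leb R _)%E; apply/seteqP; split=> x /=; rewrite !opprK.
Qed.

Lemma measurable_fun_oppr_leb :
  measurable_fun (setT : set (lebT R))
    (-%R : lebT R -> lebT R).
Proof. by move=> mT Y mY; rewrite setTI; exact: measurable_oppr_leb. Qed.

Lemma integral_leb_oppr (f : R -> \bar R) :
  (leb R).-integrable setT f -> (leb R).-integrable setT (f \o -%R) ->
  (\int[leb R]_x f (- x)%R = \int[leb R]_x f x)%E.
Proof.
move=> /[dup] /integrableP[mf _] intf intfN.
have := integral_pushforward measurable_fun_oppr_leb mf intfN measurableT.
rewrite preimage_setT => <-.
pose m' : {measure set (lebT R) -> \bar R} :=
  @measure_function_pushforward__canonical__measure_function_Measure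
    _ _ _ _ _ (leb R) _ measurable_fun_oppr_leb.
rewrite (@eq_measure_integral _ _ _ setT (leb R) m')//.
by move=> A mA _; exact: leb_oppr.
Qed.

End Reflection.

(** * Means with respect to the kernel *)

Section Kmean.
Variable R : realType.
Implicit Types (g h : R -> R).

Lemma ge0_integral_leb_oppr (f : lebT R -> \bar R) :
  measurable_fun setT f ->
  (forall x, (0 <= f x)%E) ->
  (\int[leb R]_x f (- x)%R = \int[leb R]_x f x)%E.
Proof.
move=> mf f0.
have := ge0_integral_pushforward (@measurable_fun_oppr_leb R) (leb R) measurableT mf
  (fun y _ => f0 y).
rewrite preimage_setT => <-.
pose m' : {measure set (lebT R) -> \bar R} :=
  @measure_function_pushforward__canonical__measure_function_Measure
    _ _ _ _ _ (leb R) _ (@measurable_fun_oppr_leb R).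
rewrite (@eq_measure_integral _ _ _ setT (leb R) m')//.
by move=> A mA _; exact: leb_oppr.
Qed.

(** The functions that the kernel integrates by virtue of its exponential moments:
    closed under sums, products, reflection and translation. *)
Definition tame g := measurable_fun setT g /\
  exists C A, 0 <= A /\ forall y, `|g y| <= C * expR (A * `|y|).

Definition kmean (k : R -> R) g : R := \int[leb R]_y (g y * k y).

Lemma expR_abs_le (A y : R) : expR (A * `|y|) <= expR (A * y) + expR (- A * y).
Proof.
have [y0|y0] := lerP 0 y.
  by rewrite ger0_norm// lerDl expR_ge0.
by rewrite ltr0_norm// mulrN mulNr lerDr expR_ge0.
Qed.

Lemma tame_cst (c : R) : tame (cst c).
Proof.
split; first exact: measurable_cst.
by exists `|c|, 0; split=> // y; rewrite mul0r expR0 mulr1.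
Qed.

Lemma tame_expR (c : R) : tame (fun y => expR (c * y)).
Proof.
split; first by apply: measurableT_comp => //; exact: measurable_funM.
exists 1, `|c|; split=> // y; rewrite mul1r ger0_norm ?expR_ge0//.
by rewrite ler_expR -normrM ler_norm.
Qed.

Lemma tameD g h : tame g -> tame h -> tame (fun y => g y + h y).
Proof.
move=> [mg [C [A [A0 gC]]]] [mh [D [B [B0 hD]]]].
split; first exact: measurable_funD.
exists (C + D), (A + B); split=> [|y]; first exact: addr_ge0.
have C0 : 0 <= C by have := gC 0; rewrite normr0 mulr0 expR0 mulr1; apply: le_trans.
have D0 : 0 <= D by have := hD 0; rewrite normr0 mulr0 expR0 mulr1; apply: le_trans.
rewrite (le_trans (ler_normD _ _))// mulrDl lerD//.
  by rewrite (le_trans (gC y))// ler_wpM2l// ler_expR ler_wpM2r// lerDl.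
by rewrite (le_trans (hD y))// ler_wpM2l// ler_expR ler_wpM2r// lerDr.
Qed.

Lemma tameM g h : tame g -> tame h -> tame (fun y => g y * h y).
Proof.
move=> [mg [C [A [A0 gC]]]] [mh [D [B [B0 hD]]]].
split; first exact: measurable_funM.
exists (C * D), (A + B); split=> [|y]; first exact: addr_ge0.
by rewrite normrM mulrDl expRD mulrACA ler_pM.
Qed.

Lemma tameZ (c : R) g : tame g -> tame (fun y => c * g y).
Proof. by apply: tameM; exact: tame_cst. Qed.

Lemma tameN g : tame g -> tame (fun y => - g y).
Proof.
by move=> tg; under eq_fun do rewrite -mulN1r; exact: tameZ.
Qed.

Lemma tameB g h : tame g -> tame h -> tame (fun y => g y - h y).
Proof. by move=> tg th; apply: tameD => //; exact: tameN. Qed.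

Lemma tame_bounded g (C : R) : measurable_fun setT g ->
  (forall y, `|g y| <= C) -> tame g.
Proof.
move=> mg gC; split=> //; exists C, 0; split=> // y.
by rewrite mul0r expR0 mulr1.
Qed.

Lemma tame_le g h : measurable_fun setT g -> tame h ->
  (forall y, `|g y| <= h y) -> tame g.
Proof.
move=> mg [_ [C [A [A0 hC]]]] gh; split=> //; exists C, A; split=> // y.
by rewrite (le_trans (gh y))// (le_trans _ (hC y))// ler_norm.
Qed.

Lemma tame_comp_oppr g : tame g -> tame (fun y => g (- y)).
Proof.
move=> [mg [C [A [A0 gC]]]]; split; first exact: measurableT_comp.
by exists C, A; split=> // y; rewrite (le_trans (gC _))// normrN.
Qed.

Lemma tame_comp_sub g (x : R) : tame g -> tame (fun y => g (x - y)).
Proof.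
move=> [mg [C [A [A0 gC]]]]; split.
  by apply: measurableT_comp => //; exact: measurable_funB.
have C0 : 0 <= C by have := gC 0; rewrite normr0 mulr0 expR0 mulr1; apply: le_trans.
exists (C * expR (A * `|x|)), A; split=> // y; rewrite (le_trans (gC _))//.
rewrite -mulrA ler_wpM2l// -expRD -mulrDr ler_expR ler_wpM2l//.
exact: ler_normB.
Qed.

Variable k : R -> R.
Hypothesis hk : dispersal_kernel k.

Let k0 x : 0 <= k x. Proof. exact: kernel_ge0 hk x. Qed.

Let mk : measurable_fun setT (k : lebT R -> R).
Proof. by apply/measurable_EFinP; case/integrableP: (kernel_integrable hk). Qed.

(** Negative exponents reduce to positive ones by reflection. *)
Lemma kexp_integrable (l : R) :
  (leb R).-integrable setT (fun y => (k y * expR (l * y))%:E).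
Proof.
have mexp (m : R) : measurable_fun setT
    (fun y : lebT R => (k y * expR (m * y))%:E).
  apply/measurable_EFinP; apply: measurable_funM; first exact: mk.
  by apply: borel_leb_measurable_fun; have [] := tame_expR m.
apply/integrableP; split=> //.
under eq_integral do rewrite gee0_abs ?lee_fin ?mulr_ge0 ?expR_ge0//.
have [l0|l0] := lerP 0 l; first exact: kernel_exp_moment.
rewrite -ge0_integral_leb_oppr//; last first.
  by move=> x; rewrite lee_fin mulr_ge0 ?expR_ge0.
under eq_integral do rewrite -(kernel_even hk) mulrN -mulNr.
by apply: kernel_exp_moment => //; rewrite oppr_ge0 ltW.
Qed.

Lemma tame_measurable_k g : tame g ->
  measurable_fun setT (fun y : lebT R => g y * k y).
Proof.
by move=> [mg _]; apply: measurable_funM; [exact: borel_leb_measurable_fun|exact: mk].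
Qed.

Lemma tame_integrable g : tame g ->
  (leb R).-integrable setT (EFin \o (fun y => g y * k y)).
Proof.
move=> tg; have [mg [C [A [A0 gC]]]] := tg.
have C0 : 0 <= C by have := gC 0; rewrite normr0 mulr0 expR0 mulr1; apply: le_trans.
apply: (@le_integrable _ _ _ (leb R) setT measurableT _
  (fun y => C%:E * ((k y * expR (A * y))%:E + (k y * expR (- A * y))%:E))%E).
- exact/measurable_EFinP/tame_measurable_k.
- move=> y _ /=; rewrite lee_fin normrM (ger0_norm (k0 y)).
  rewrite [leRHS]ger0_norm ?mulr_ge0 ?addr_ge0 ?mulr_ge0 ?expR_ge0//.
  rewrite -mulrDr (mulrCA C) (mulrC _ (k y)) ler_wpM2l//.
  by rewrite (le_trans (gC y))// ler_wpM2l// expR_abs_le.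
- by apply: integrableZl => //; apply: integrableD => //; exact: kexp_integrable.
Qed.

Lemma kmeanD g h : tame g -> tame h ->
  kmean k (fun y => g y + h y) = kmean k g + kmean k h.
Proof.
move=> tg th; rewrite /kmean; under eq_Rintegral do rewrite mulrDl.
by apply: RintegralD => //; exact: tame_integrable.
Qed.

Lemma kmeanZ (c : R) g : tame g -> kmean k (fun y => c * g y) = c * kmean k g.
Proof.
move=> tg; rewrite /kmean; under eq_Rintegral do rewrite -mulrA.
by apply: RintegralZl => //; exact: tame_integrable.
Qed.

Lemma kmeanB g h : tame g -> tame h ->
  kmean k (fun y => g y - h y) = kmean k g - kmean k h.
Proof.
move=> tg th; rewrite /kmean; under eq_Rintegral do rewrite mulrBl.
by apply: RintegralB => //; exact: tame_integrable.
Qed.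

Lemma eq_kmean g h : g =1 h -> kmean k g = kmean k h.
Proof. by move=> /funext ->. Qed.

Lemma kmean_le g h : tame g -> tame h -> (forall y, g y <= h y) ->
  kmean k g <= kmean k h.
Proof.
move=> tg th gh; apply: le_Rintegral => //; try exact: tame_integrable.
by move=> y _; rewrite ler_wpM2r.
Qed.

Lemma kmean_cst (c : R) : kmean k (cst c) = c.
Proof.
rewrite /kmean RintegralZl//; last exact: (kernel_integrable hk).
by rewrite /Rintegral (kernel_mass1 hk)/= mulr1.
Qed.

Lemma kmean_ge0 g : (forall y, 0 <= g y) -> 0 <= kmean k g.
Proof. by move=> g0; apply: Rintegral_ge0 => y _; rewrite mulr_ge0. Qed.

Lemma kmean_oppr g : tame g -> kmean k (fun y => g (- y)) = kmean k g.
Proof.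
move=> tg; rewrite /kmean /Rintegral; congr fine.
rewrite -[RHS]integral_leb_oppr; [|exact: tame_integrable|].
  by apply: eq_integral => x _; rewrite -(kernel_even hk).
have := tame_integrable (tame_comp_oppr tg); congr (_.-integrable _ _).
by apply/funext => y /=; rewrite -(kernel_even hk).
Qed.

Lemma kmean_cvg (g_ : nat -> R -> R) g h :
  (forall n, measurable_fun setT (g_ n)) -> tame h ->
  (forall n y, `|g_ n y| <= h y) ->
  (forall y, g_ ^~ y @ \oo --> g y) ->
  kmean k (g_ n) @[n --> \oo] --> kmean k g.
Proof.
move=> mg th gh gg.
have tg n : tame (g_ n) by exact: tame_le (th) (gh n).
have mg' : measurable_fun setT g.
  by apply: (@measurable_fun_cvg _ _ _ setT g_) => // y _; exact: gg.
have tg' : tame g.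
  apply: tame_le (th) _ => // y.
  have ngg : `|g_ n y| @[n --> \oo] --> `|g y| by apply: cvg_norm; exact: gg.
  rewrite -(cvg_lim _ ngg)//; apply: limr_le; first by apply/cvg_ex; exists `|g y|.
  by apply: nearW => n; exact: gh.
have h0 y : 0 <= h y by exact: le_trans (gh 0%N y).
rewrite /kmean /Rintegral; apply: fine_cvg.
rewrite fineK; last exact: integrable_fin_num (tame_integrable tg').
apply: (@dominated_cvg _ _ _ (leb R) setT measurableT
   (fun n y => (g_ n y * k y)%:E) (fun y => (g y * k y)%:E)
   (fun y => (h y * k y)%:E)).
- by move=> n; exact: measurable_int (tame_integrable (tg n)).
- by move=> y _; apply: cvg_EFin; [exact: nearW|apply: cvgMl; exact: gg].
- by [].
- exact: tame_integrable.
- by move=> n y _ /=; rewrite lee_fin normrM (ger0_norm (k0 y)) ler_wpM2r.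
Qed.

(** A non-negative weight of mean zero vanishes almost everywhere where the
    kernel does not, hence kills every other factor. *)
Lemma kmean_mul_eq0 g h : tame g -> (forall y, 0 <= g y) -> kmean k g = 0 ->
  tame (fun y => h y * g y) -> kmean k (fun y => h y * g y) = 0.
Proof.
move=> tg g0 kg0 thg.
have mg : measurable_fun setT (fun y : lebT R => (g y * k y)%:E).
  exact: measurable_int (tame_integrable tg).
have : (\int[leb R]_y `|(g y * k y)%:E| = 0)%E.
  under eq_integral do rewrite gee0_abs ?lee_fin ?mulr_ge0//.
  rewrite -[LHS]fineK; first by congr EFin.
  exact: integrable_fin_num (tame_integrable tg).
move=> /(ae_eq_integral_abs _ measurableT mg) gk0.
rewrite /kmean /Rintegral (@ae_eq_integral _ _ _ (leb R) setT (cst 0%E)).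
- by rewrite integral0.
- exact: measurableT.
- exact: measurable_int (tame_integrable thg).
- exact: measurable_cst.
apply: filterS gk0 => y /(_ I) [gk0] _ /=.
by rewrite -mulrA gk0 mulr0.
Qed.

Lemma leb_set1 (p : R) : leb R [set p] = 0%E.
Proof. exact: lebesgue_measure_set1. Qed.

Lemma kmean_indic1 (p : R) : kmean k \1_[set p] = 0.
Proof.
have mp : measurable ([set p] : set (lebT R)) by exact: borel_leb_measurable.
have tp : tame (\1_[set p] : R -> R).
  apply: (@tame_bounded _ 1); first exact: measurable_indic.
  by move=> y; rewrite indicE; case: (_ \in _); rewrite ?normr1 ?normr0.
rewrite /kmean /Rintegral (@ae_eq_integral _ _ _ (leb R) setT (cst 0%E)).
- by rewrite integral0.
- exact: measurableT.
- exact: measurable_int (tame_integrable tp).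
- exact: measurable_cst.
exists [set p]; split=> //; first exact: leb_set1.
move=> y /=; apply: contra_notP => /eqP yp _.
by rewrite indicE memNset ?mul0r//; exact/eqP.
Qed.

(** The kernel has no atoms, so positivity off one point suffices. *)
Lemma kmean_gt0 g (p : R) : tame g -> (forall y, 0 <= g y) ->
  (forall y, y != p -> 0 < g y) -> 0 < kmean k g.
Proof.
move=> tg g0 gp; rewrite lt_neqAle kmean_ge0// andbT eq_sym.
apply/eqP => kg0.
pose h y := 1 - \1_[set p] y : R.
have tp : tame (\1_[set p] : R -> R).
  apply: (@tame_bounded _ 1); first exact: measurable_indic.
  by move=> y; rewrite indicE; case: (_ \in _); rewrite ?normr1 ?normr0.
have th : tame h by apply: tameB => //; exact: tame_cst.
have hE y : (h y / g y) * g y = h y.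
  rewrite /h indicE; have [->|yp] := eqVneq y p.
    by rewrite mem_set// subrr !mul0r.
  by rewrite divfK// gt_eqF// gp.
have E : (fun y => (h y / g y) * g y) = h by exact/funext.
have := @kmean_mul_eq0 g (fun y => h y / g y) tg g0 kg0.
rewrite E => /(_ th); rewrite /h kmeanB//; last exact: tame_cst.
by rewrite kmean_indic1 kmean_cst subr0 => /eqP; rewrite oner_eq0.
Qed.

End Kmean.

(** * Exponential moments *)

Section Moments.
Variable R : realType.
Variable k : R -> R.
Hypothesis hk : dispersal_kernel k.
Implicit Types (g h u : R -> R).

Lemma kmean_continuous_at (G : R -> R -> R) h (a : R) :
  (forall x, measurable_fun setT (G x)) -> tame h ->
  (\forall x \near a, forall y, `|G x y| <= h y) ->
  (forall y, G x y @[x --> a] --> G a y) ->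
  kmean k (G x) @[x --> a] --> kmean k (G a).
Proof.
move=> mG th Gh cG; apply/(@cvg_nbhsP _ R^o) => w wa.
have [N _ HN] := wa _ Gh.
rewrite -(cvg_shiftn N); apply: (kmean_cvg hk _ th) => //.
- by move=> n y; apply: HN => /=; exact: leq_addl.
- move=> y; rewrite (cvg_shiftn N (fun n => G (w n) y)).
  by have /(@cvg_nbhsP _ R^o) := cG y; apply.
Qed.

Lemma tame_id : tame (@idfun R).
Proof.
split; first exact: measurable_id.
exists 1, 1; split=> // y; rewrite !mul1r /=.
by rewrite (le_trans _ (expR_ge1Dx _))// lerDr.
Qed.

Lemma tame_norm : tame (fun y : R => `|y|).
Proof.
split; first exact: measurableT_comp.
exists 1, 1; split=> // y; rewrite normr_id !mul1r.
by rewrite (le_trans _ (expR_ge1Dx _))// lerDr.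
Qed.

Definition moment (l : R) : R := kmean k (fun y => expR (l * y)).

Lemma kmean_id0 : kmean k idfun = 0.
Proof.
have := kmean_oppr hk tame_id.
under eq_kmean do rewrite /= -mulN1r.
by rewrite (kmeanZ hk _ tame_id) => ?; lra.
Qed.

(** Jensen's inequality in the form [1 + l y <= exp (l y)]: the kernel has mean
    zero. *)
Lemma mom_ge1 l : 1 <= moment l.
Proof.
have <- : kmean k (fun y => 1 + l * y) = 1.
  rewrite (kmeanD hk (tame_cst 1) (tameZ l tame_id)) (kmean_cst hk).
  by rewrite (kmeanZ hk _ tame_id) kmean_id0 mulr0 addr0.
apply: (kmean_le hk); [|exact: tame_expR|by move=> y; exact: expR_ge1Dx].
by apply: tameD; [exact: tame_cst|exact: tameZ tame_id].
Qed.

Lemma mom_opp l : moment (- l) = moment l.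
Proof.
rewrite /moment -(kmean_oppr hk (tame_expR l)).
by apply: eq_kmean => y; rewrite mulrN mulNr.
Qed.

Lemma mom_continuous : continuous moment.
Proof.
move=> l; apply: (@kmean_continuous_at (fun x y => expR (x * y))
  (fun y => expR ((`|l| + 1) * y) + expR (- (`|l| + 1) * y))).
- by move=> x; have [] := tame_expR x.
- by apply: tameD; exact: tame_expR.
- near=> x => y; rewrite ger0_norm ?expR_ge0//.
  apply: le_trans (expR_abs_le _ _); rewrite ler_expR.
  rewrite (le_trans (ler_norm _))// normrM ler_wpM2r//.
  have -> : x = l + (x - l) by rewrite addrC subrK.
  rewrite (le_trans (ler_normD _ _))// lerD2l.
  near: x; apply: cvgr_norm_le => /=.
    by apply: cvgB; [exact: cvg_id|exact: cvg_cst].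
  by rewrite subrr normr0.
- move=> y; apply: continuous_cvg; first exact: continuous_expR.
  by apply: cvgMl; exact: cvg_id.
Unshelve. all: by end_near. Qed.

(** A second-order Taylor bound obtained from [1 + t <= exp t] alone, used at
    [t = x] and [t = - x]. *)
Lemma expR_taylor2 (x : R) : expR x <= 1 + x + x ^+ 2 * expR `|x|.
Proof.
have h1 := expR_ge1Dx (- x).
have h2 := expR_ge1Dx x.
have e0 := expR_gt0 x.
have e1 : 1 <= expR `|x| by rewrite -expR0 ler_expR.
have h3 : expR x - 1 <= x * expR x.
  have : expR x * (1 - x) <= expR x * expR (- x) by rewrite ler_pM2l//; lra.
  by rewrite expRxMexpNx_1; lra.
have [x0|x0] := lerP 0 x; first by rewrite ger0_norm//; nra.
have h4 : x ^+ 2 <= x ^+ 2 * expR `|x| by rewrite ler_peMr// sqr_ge0.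
have h5 : x * (expR x - 1 - x) <= 0 by rewrite nmulr_rle0//; lra.
by rewrite expr2 in h4 *; lra.
Qed.

End Moments.

(** * The critical speed is attained *)

Section Critical.
Variable R : realType.
Variable k : R -> R.
Hypothesis hk : dispersal_kernel k.
Variable d : R.
Hypothesis d0 : 0 < d.
Notation mom := (moment k).
Notation c := (cstar d k).

(** The speed of the linear front with exponent [l]. *)
Definition rate (l : R) : R := ln ((1 + d) * mom l) / l.

Lemma growth_mom_gt1 l : 1 < (1 + d) * mom l.
Proof.
have h := mom_ge1 hk l; have h3 := d0.
have : 0 <= d * (mom l - 1) by rewrite mulr_ge0 ?(ltW d0)// subr_ge0.
by move=> ?; lra.
Qed.

Lemma rate_ge l : 0 < l -> ln (1 + d) / l <= rate l.
Proof.
move=> l0; have h1 := mom_ge1 hk l; have h2 := growth_mom_gt1 l; have h3 := d0.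
rewrite /rate ler_pM2r ?invr_gt0// ler_ln ?posrE; [nra|lra|lra].
Qed.

Lemma lnd_gt0 : 0 < ln (1 + d). Proof. by rewrite ln_gt0// ltrDl. Qed.

Lemma cstarE : c = inf [set rate l | l in [set l : R | 0 < l]].
Proof. by []. Qed.

Lemma rate_has_lbound : has_lbound [set rate l | l in [set l : R | 0 < l]].
Proof.
exists 0 => _ [l /= l0 <-]; apply: le_trans (rate_ge l0).
by rewrite divr_ge0 ?ltW// lnd_gt0.
Qed.

Lemma cstar_le_rate l : 0 < l -> c <= rate l.
Proof. by move=> l0; rewrite cstarE; apply: ge_inf; [exact: rate_has_lbound|exists l]. Qed.

Lemma rate_adherent e : 0 < e -> exists l, 0 < l /\ rate l < c + e.
Proof.
move=> e0; have hi : has_inf [set rate l | l in [set l : R | 0 < l]].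
  by split; [exists (rate 1); exists 1 => //=; exact: ltr01|exact: rate_has_lbound].
by have [_ [l l0 <-] le] := inf_adherent e0 hi; exists l.
Qed.

Lemma cstar_ge0 : 0 <= c.
Proof.
rewrite cstarE; apply: lb_le_inf; first by exists (rate 1); exists 1 => //=; exact: ltr01.
move=> _ [l /= l0 <-]; apply: le_trans (rate_ge l0).
by rewrite divr_ge0 ?ltW// lnd_gt0.
Qed.

Lemma rate_lt_mom l e : 0 < l -> rate l < e -> (1 + d) * mom l < expR (l * e).
Proof.
move=> l0; rewrite /rate ltr_pdivrMr// (mulrC e) => h.
have h3 := d0; rewrite -ltr_ln ?posrE ?expR_gt0//; last by have := growth_mom_gt1 l; lra.
by rewrite expRK.
Qed.

Lemma mom_ge_cstar l : 0 < l -> expR (l * c) <= (1 + d) * mom l.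
Proof.
move=> l0; have := cstar_le_rate l0; rewrite /rate ler_pdivlMr// (mulrC c) => h.
have h3 := d0; rewrite -ler_ln ?posrE ?expR_gt0//; last by have := growth_mom_gt1 l; lra.
by rewrite expRK.
Qed.

Lemma kmean_expR_sub l (e : R) :
  kmean k (fun y => expR (l * (y - e))) = expR (- l * e) * mom l.
Proof.
rewrite -(kmeanZ hk _ (tame_expR l)); apply: eq_kmean => y.
by rewrite -expRD; congr expR; ring.
Qed.

Lemma tame_expR_sub l (e : R) : tame (fun y => expR (l * (y - e))).
Proof.
suff -> : (fun y => expR (l * (y - e))) = (fun y => expR (- l * e) * expR (l * y)).
  exact: tameZ (tame_expR l).
by apply/funext => y; rewrite -expRD; congr expR; ring.
Qed.

Lemma tame_max0_sub (e : R) : tame (fun y : R => Num.max 0 (y - e)).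
Proof.
apply: (@tame_le _ _ (fun y => `|y - e|)).
- apply: measurable_maxr; first exact: measurable_cst.
  by apply: measurable_funB; [exact: measurable_id|exact: measurable_cst].
- have := @tame_comp_sub _ _ e (tame_norm R).
  by under eq_fun do rewrite distrC.
- by move=> y; rewrite ger0_norm ?le_max ?lexx// ge_max normr_ge0/= ler_norm.
Qed.

(** If the infimum were approached along exponents tending to infinity, then the
    means of [exp (l (y - c - e))] would stay bounded along them; since
    [l (y - c - e)] lies below that exponential, the kernel would not charge the
    points beyond [c]. *)
Lemma kmean_beyond0 :
  (forall L e, 0 < e -> exists2 l, L <= l & rate l < c + e) ->
  kmean k (fun y => Num.max 0 (y - c)) = 0.
Proof.
move=> H.
have step1 e : 0 < e -> kmean k (fun y => Num.max 0 (y - (c + e))) <= 0.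
  move=> e0; apply/ler_addgt0Pr => t t0; rewrite add0r.
  have [l lt rl] := H (t^-1) _ e0.
  have l0 : 0 < l by apply: lt_le_trans lt; rewrite invr_gt0.
  have := rate_lt_mom l0 rl => hm.
  have h1 : kmean k (fun y => expR (l * (y - (c + e)))) <= 1.
    rewrite kmean_expR_sub.
    have h2 : mom l <= expR (l * (c + e)).
      have := mom_ge1 hk l => m1.
      by apply/ltW/(le_lt_trans _ hm); rewrite ler_peMl ?lerDl ?(ltW d0)//; lra.
    rewrite (le_trans (ler_wpM2l (expR_ge0 _) h2))// -expRD.
    by rewrite mulNr addNr expR0.
  apply: (@le_trans _ _ (l^-1 * kmean k (fun y => expR (l * (y - (c + e)))))).
    have te := tame_expR_sub l (c + e).
    rewrite -(kmeanZ hk _ te); apply: (kmean_le hk); [exact: tame_max0_sub|exact: tameZ|].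
    move=> y; rewrite ge_max mulr_ge0 ?invr_ge0 ?(ltW l0) ?expR_ge0//= ler_pdivlMl//.
    by have := expR_ge1Dx (l * (y - (c + e))); lra.
  rewrite (le_trans (ler_wpM2l _ h1)) ?invr_ge0 ?(ltW l0)// mulr1.
  by rewrite invf_ple ?posrE.
apply/eqP; rewrite eq_le kmean_ge0 ?andbT//; last by move=> y; rewrite le_max lexx.
apply/ler_addgt0Pr => e e0; rewrite add0r.
apply: (@le_trans _ _ (kmean k (fun y => e + Num.max 0 (y - (c + e))))).
  apply: (kmean_le hk); [exact: tame_max0_sub| |].
    by apply: tameD; [exact: tame_cst|exact: tame_max0_sub].
  move=> y; rewrite ge_max addr_ge0 ?(ltW e0) ?le_max ?lexx//=.
  by rewrite addr_maxr le_max; apply/orP; right; lra.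
rewrite (kmeanD hk (tame_cst e) (tame_max0_sub _)) (kmean_cst hk).
by have := step1 _ e0; lra.
Qed.

Lemma tame_expRN_dist (n : nat) (e : R) : tame (fun y => expR (- (n%:R * `|y - e|))).
Proof.
apply: (@tame_bounded _ _ 1).
  apply: measurableT_comp => //; apply: measurableT_comp => //.
  apply: measurable_funM; first exact: measurable_cst.
  apply: measurableT_comp => //.
  by apply: measurable_funB; [exact: measurable_id|exact: measurable_cst].
move=> y; by rewrite ger0_norm ?expR_ge0// -expR0 ler_expR oppr_le0 mulr_ge0.
Qed.

(** The functions decrease to the indicator of a point, which has no mass. *)
Lemma kmean_concentrate (e : R) :
  kmean k (fun y => expR (- (n%:R * `|y - e|))) @[n --> \oo] --> 0.
Proof.
rewrite -(kmean_indic1 hk e).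
apply: (kmean_cvg hk _ (tame_cst 1)).
- by move=> n; have [] := tame_expRN_dist n e.
- move=> n y; by rewrite ger0_norm ?expR_ge0// -expR0 ler_expR oppr_le0 mulr_ge0.
move=> y; rewrite indicE; have [->|ye] := eqVneq y e.
  rewrite mem_set//; under eq_fun do rewrite subrr normr0 mulr0 oppr0 expR0.
  exact: cvg_cst.
rewrite memNset/=; last exact/eqP.
have ye0 : 0 < `|y - e| by rewrite normr_gt0 subr_eq0.
have q1 : `|expR (- `|y - e|)| < 1.
  by rewrite ger0_norm ?expR_ge0// -expR0 ltr_expR oppr_lt0.
have := cvg_geometric 1 q1; apply: cvg_trans; apply: near_eq_cvg; near=> n => /=.
by rewrite mul1r -expRM_natl -mulr_natl mulrN.
Unshelve. all: by end_near. Qed.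

(** Otherwise the kernel lives on [y <= c] by [kmean_beyond0], so the mean of
    [exp (n (y - c))] is that of [exp (- n |y - c|)] and tends to zero, whereas
    [mom_ge_cstar] keeps it above [1 / (1 + d)]. *)
Lemma rate_far : exists L e, 0 < e /\ forall l, L <= l -> c + e <= rate l.
Proof.
apply: contrapT => H.
have kp0 : kmean k (fun y => Num.max 0 (y - c)) = 0.
  apply: kmean_beyond0 => L e e0; apply: contrapT => H1; apply: H.
  exists L, e; split=> // l Ll; rewrite leNgt; apply/negP => rl.
  by apply: H1; exists l.
have kE n : kmean k (fun y => expR (n%:R * (y - c))) =
            kmean k (fun y => expR (- (n%:R * `|y - c|))).
  pose p y := Num.max 0 (y - c).
  pose q y := expR (n%:R * (y - c)) - expR (- (n%:R * `|y - c|)).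
  have tq : tame q by apply: tameB; [exact: tame_expR_sub|exact: tame_expRN_dist].
  apply/eqP; rewrite -subr_eq0 -(kmeanB hk (tame_expR_sub _ _) (tame_expRN_dist _ _)).
  have qE : (fun y => (q y / p y) * p y) = q.
    apply/funext => y; have [yc|yc] := lerP (y - c) 0.
      rewrite /q /p ler0_norm// max_l// mulr0.
      by apply/esym/eqP; rewrite subr_eq0; apply/eqP; congr expR; ring.
    by rewrite divfK// /p max_r ?ltW// gt_eqF.
  have := @kmean_mul_eq0 _ _ hk p (fun y => q y / p y).
  rewrite qE => h; apply/eqP/h => //; first exact: tame_max0_sub.
  by move=> y; rewrite le_max lexx.
have lim0 := kmean_concentrate c.
have : \forall n \near \oo, kmean k (fun y => expR (- (n%:R * `|y - c|))) < (1 + d)^-1.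
  have pos : 0 < (1 + d)^-1 by rewrite invr_gt0 ltr_wpDl// ltW.
  by apply: (cvgr_lt _ lim0).
move=> [N _ HN].
(* [N.+1] rather than [N]: the exponent has to be positive *)
have := HN N.+1 (leqnSn N); rewrite /= -kE kmean_expR_sub.
have N0 : (0 < N.+1%:R :> R) by rewrite ltr0n.
have := mom_ge_cstar N0 => h.
apply/negP; rewrite -leNgt mulNr expRN ler_pdivlMl ?expR_gt0//.
by rewrite ler_pdivrMr ?(mulrC _ (1 + d))// ltr_wpDl// ltW.
Qed.

Lemma rate_continuous l : 0 < l -> {for l, continuous rate}.
Proof.
move=> l0; apply: (@cvgM _ _ _ _ (fun l => ln ((1 + d) * mom l)) (fun l => l^-1)).
  apply: (@cvg_comp _ _ _ (fun l => (1 + d) * mom l) (@ln R) _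
    (nbhs ((1 + d) * mom l))); first by apply: cvgMr; exact: mom_continuous.
  by apply: continuous_ln; have := growth_mom_gt1 l; lra.
by apply: cvgV; rewrite ?gt_eqF.
Qed.

Lemma rate_near0 : exists2 e, 0 < e & forall l, 0 < l <= e -> c + 1 <= rate l.
Proof.
have c0 := cstar_ge0; have l0 := lnd_gt0.
exists (ln (1 + d) / (c + 1)); first by rewrite divr_gt0//; lra.
move=> l /andP[lp le]; apply: le_trans (rate_ge lp).
rewrite ler_pdivlMr// mulrC -ler_pdivlMr//; lra.
Qed.

(** The rate blows up at zero and stays away from the infimum at infinity, so the
    infimum is a minimum over a compact interval. *)
Lemma critical_exponent : exists2 lam, 0 < lam & rate lam = c.
Proof.
have [L [e [e0 far]]] := rate_far.
have [t t0 near0] := rate_near0.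
pose b := Num.max t L.
have tb : t <= b by rewrite le_max lexx.
have cr : {within `[t, b], continuous rate}.
  apply: continuous_in_subspaceT => x; rewrite inE/= in_itv/= => /andP[tx _].
  by apply: rate_continuous; exact: lt_le_trans tx.
have [lam + lamP] := EVT_min tb cr.
rewrite in_itv/= => /andP[tl lb]; have lam0 : 0 < lam by exact: lt_le_trans tl.
exists lam => //; apply/eqP; rewrite eq_le cstar_le_rate// andbT leNgt.
apply/negP => cl.
pose m := Num.min (Num.min e 1) (rate lam - c).
have m0 : 0 < m by rewrite !lt_min e0 ltr01 subr_gt0.
have [l [lp rl]] := rate_adherent m0.
have me : m <= e by rewrite /m !ge_min lexx.
have m1 : m <= 1 by rewrite /m !ge_min lexx orbT.
have ml : m <= rate lam - c by rewrite /m !ge_min lexx !orbT.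
have [lt|lt] := leP l t.
  by have := near0 l; rewrite lp lt => /(_ isT); lra.
have [Ll|lL] := leP L l; first by have := far _ Ll; lra.
have : rate lam <= rate l.
  by apply: lamP; rewrite in_itv/= (ltW lt)/= le_max (ltW lL) orbT.
by lra.
Qed.

End Critical.

(** * First- and second-order conditions at the critical exponent *)

Section Critical2.
Variable R : realType.
Variable k : R -> R.
Hypothesis hk : dispersal_kernel k.
Variable d : R.
Hypothesis d0 : 0 < d.
Notation mom := (moment k).
Notation c := (cstar d k).
Variable lam : R.
Hypothesis lam0 : 0 < lam.
Hypothesis ratelam : rate k d lam = c.

Lemma critical_mom : (1 + d) * mom lam = expR (lam * c).
Proof.
have g1 := growth_mom_gt1 hk d0 lam.
rewrite -ratelam /rate (mulrC lam) divfK ?gt_eqF// lnK// posrE; lra.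
Qed.

Lemma cstar_gt0 : 0 < c.
Proof.
rewrite -ratelam; apply: lt_le_trans (rate_ge hk d0 lam0).
by rewrite divr_gt0 ?lnd_gt0.
Qed.

Let z (y : R) := y - c.
Let w (y : R) := expR (lam * z y).

Lemma tame_z : tame z.
Proof. by apply: tameB; [exact: tame_id|exact: tame_cst]. Qed.

Lemma tame_w : tame w. Proof. exact: tame_expR_sub. Qed.

Lemma tame_expz : tame (fun y => expR `|z y|).
Proof.
have te : tame (fun y : R => expR `|y|).
  split; first by apply: measurableT_comp => //; apply: measurableT_comp.
  by exists 1, 1; split=> // y; rewrite ger0_norm ?expR_ge0// !mul1r.
suff -> : (fun y => expR `|z y|) = (fun y => expR `|c - y|) by exact: (tame_comp_sub c te).
by apply/funext => y; rewrite distrC.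
Qed.

Lemma kmean_w_shift h : kmean k (fun y => w y * expR (h * z y)) =
  expR (- (lam + h) * c) * mom (lam + h).
Proof.
rewrite -(kmean_expR_sub hk); apply: eq_kmean => y.
by rewrite /w /z -expRD; congr expR; ring.
Qed.

Lemma kmean_w : kmean k w = (1 + d)^-1.
Proof.
rewrite /w /z (kmean_expR_sub hk) mulNr expRN -critical_mom invfM -mulrA mulVf ?mulr1//.
by rewrite gt_eqF// (lt_le_trans ltr01)// mom_ge1.
Qed.

(** The minimality of [lam], written for the tilted kernel. *)
Lemma kmean_w_shift_ge h : 0 < lam + h ->
  (1 + d)^-1 <= kmean k (fun y => w y * expR (h * z y)).
Proof.
move=> lh; rewrite kmean_w_shift mulNr expRN ler_pdivlMl ?expR_gt0//.
rewrite ler_pdivrMr; last by rewrite ltr_wpDl// ltW.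
by rewrite (mulrC (mom _)); exact: (mom_ge_cstar hk d0 lh).
Qed.

(** The first-order condition at the minimum: the kernel tilted by [exp (lam y)]
    has mean [c].  The mean of [w exp (h z)] exceeds its value at [h = 0] by at
    most [h m1 + h ^ 2 M], and this must be non-negative for small [h] of either
    sign. *)
Lemma kmean_zw0 : kmean k (fun y => z y * w y) = 0.
Proof.
set m1 := kmean k _.
pose q y := z y ^+ 2 * expR `|z y| * w y.
have tq : tame q.
  apply: tameM; last exact: tame_w.
  apply: tameM; last exact: tame_expz.
  by under eq_fun do rewrite expr2; apply: tameM; exact: tame_z.
have tzw : tame (fun y => z y * w y) by apply: tameM; [exact: tame_z|exact: tame_w].
pose M := kmean k q.
have M0 : 0 <= M.
  apply: (kmean_ge0 hk) => y; rewrite /q; apply: mulr_ge0; last exact: expR_ge0.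
  by apply: mulr_ge0; [exact: sqr_ge0|exact: expR_ge0].
have key h : `|h| <= 1 -> 0 < lam + h -> 0 <= h * m1 + h ^+ 2 * M.
  move=> h1 lh; rewrite -(lerD2l (kmean k w)) addr0 {1}kmean_w addrA.
  apply: (le_trans (kmean_w_shift_ge lh)).
  rewrite -(kmeanZ hk h tzw) -(kmeanZ hk (h ^+ 2) tq).
  have tD : tame (fun y => w y + h * (z y * w y)).
    by apply: tameD; [exact: tame_w|exact: tameZ].
  rewrite -(kmeanD hk tame_w (tameZ h tzw)) -(kmeanD hk tD (tameZ _ tq)).
  apply: (kmean_le hk).
  - apply: tameM; first exact: tame_w; exact: tame_expR_sub.
  - by apply: tameD => //; exact: tameZ.
  move=> y.
  have -> : w y + h * (z y * w y) + h ^+ 2 * q y =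
     w y * (1 + h * z y + (h * z y) ^+ 2 * expR `|z y|) by rewrite /q; ring.
  rewrite ler_wpM2l ?expR_ge0//; apply: le_trans (expR_taylor2 _) _.
  rewrite lerD2l ler_wpM2l ?sqr_ge0// ler_expR normrM ler_piMl//.
have small e : 0 < e -> `|m1| <= e.
  move=> e0; pose h := Num.min (Num.min 1 (lam / 2)) (e / (M + 1)).
  have h0 : 0 < h by rewrite !lt_min ltr01 !divr_gt0//; lra.
  have h1 : h <= 1 by rewrite !ge_min lexx.
  have hl : h <= lam / 2 by rewrite !ge_min lexx orbT.
  have hM : h * (M + 1) <= e by rewrite -ler_pdivlMr ?ge_min ?lexx ?orbT//; lra.
  have hh := lam0.
  have k1 : 0 <= h * m1 + h ^+ 2 * M by apply: key; rewrite ?gtr0_norm//; lra.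
  have k2 : 0 <= - h * m1 + (- h) ^+ 2 * M.
    by apply: key; rewrite ?normrN ?gtr0_norm//; lra.
  (* the two inequalities divided by [h], with [h M <= e] *)
  rewrite ler_norml; apply/andP; split; rewrite -(ler_pM2l h0); nra.
by apply/eqP; rewrite -normr_le0; apply/ler_addgt0Pr => e e0; rewrite add0r small.
Qed.

(** Strictness comes from [1 + t < exp t] for [t <> 0] applied to [t = h z], which
    fails only at [y = c]. *)
Lemma mom_gt_cstar h : h != 0 -> 0 < lam + h ->
  expR ((lam + h) * c) < (1 + d) * mom (lam + h).
Proof.
move=> hn0 lh.
pose g y := w y * (expR (h * z y) - (1 + h * z y)).
have tzw : tame (fun y => z y * w y) by apply: tameM; [exact: tame_z|exact: tame_w].
have twe : tame (fun y => w y * expR (h * z y)).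
  by apply: tameM; [exact: tame_w|exact: tame_expR_sub].
have twz : tame (fun y => w y + h * (z y * w y)).
  by apply: tameD; [exact: tame_w|exact: tameZ].
have gE : g = (fun y => w y * expR (h * z y) - (w y + h * (z y * w y))).
  by apply/funext => y; rewrite /g; ring.
have tg : tame g by rewrite gE; exact: tameB.
have : 0 < kmean k g.
  apply: (kmean_gt0 hk (p := c)) => // y.
    by rewrite mulr_ge0 ?expR_ge0// subr_ge0 expR_ge1Dx.
  move=> yc; rewrite mulr_gt0 ?expR_gt0// subr_gt0 expR_gt1Dx//.
  by rewrite mulf_neq0// subr_eq0.
rewrite gE (kmeanB hk twe twz) (kmeanD hk tame_w (tameZ h tzw)) (kmeanZ hk h tzw).
rewrite kmean_zw0 mulr0 addr0 kmean_w kmean_w_shift subr_gt0.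
rewrite mulNr expRN ltr_pdivlMl ?expR_gt0//.
rewrite ltr_pdivrMr; last by rewrite ltr_wpDl// ltW.
by rewrite (mulrC (mom _)).
Qed.

Lemma kmean_id_expR : kmean k (fun y => y * expR (lam * y)) = c * mom lam.
Proof.
have tzw : tame (fun y => z y * w y) by apply: tameM; [exact: tame_z|exact: tame_w].
have te : tame (fun y => y * expR (lam * y)).
  by apply: tameM; [exact: tame_id|exact: tame_expR].
have : kmean k (fun y => expR (- lam * c) * (y * expR (lam * y) - c * expR (lam * y))) = 0.
  rewrite -kmean_zw0; apply: eq_kmean => y; rewrite /w /z.
  have -> : expR (lam * (y - c)) = expR (- lam * c) * expR (lam * y).
    by rewrite -expRD; congr expR; ring.
  by ring.
have tce := tameZ c (tame_expR lam).
rewrite (kmeanZ hk _ (tameB te tce)) (kmeanB hk te tce) (kmeanZ hk _ (tame_expR lam)).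
move/eqP; rewrite mulf_eq0 gt_eqF ?expR_gt0//= subr_eq0 => /eqP ->.
by [].
Qed.

End Critical2.

(** * The critical linear operator *)

Section Operator.
Variable R : realType.
Variable k : R -> R.
Hypothesis hk : dispersal_kernel k.
Variables (d c : R).
Hypothesis d0 : 0 < d.
Implicit Types (u v : R -> R).

(** The linearization at zero, in the frame moving with speed [c]. *)
Definition linop u x := (1 + d) * kmean k (fun y => u (x - c - y)).

Lemma linD u v x : tame u -> tame v -> linop (fun s => u s + v s) x = linop u x + linop v x.
Proof.
move=> tu tv; rewrite /linop -mulrDr; congr (_ * _).
by rewrite -(kmeanD hk (tame_comp_sub _ tu) (tame_comp_sub _ tv)).
Qed.

Lemma linZ b u x : tame u -> linop (fun s => b * u s) x = b * linop u x.
Proof.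
move=> tu; rewrite /linop mulrCA; congr (_ * _).
by rewrite -(kmeanZ hk _ (tame_comp_sub _ tu)).
Qed.

Lemma linB u v x : tame u -> tame v -> linop (fun s => u s - v s) x = linop u x - linop v x.
Proof.
move=> tu tv; rewrite /linop -mulrBr; congr (_ * _).
by rewrite -(kmeanB hk (tame_comp_sub _ tu) (tame_comp_sub _ tv)).
Qed.

Lemma lin_le u v x : tame u -> tame v -> (forall s, u s <= v s) -> linop u x <= linop v x.
Proof.
move=> tu tv uv; rewrite /linop ler_wpM2l//; first by rewrite addr_ge0// ltW.
apply: (kmean_le hk); [exact: tame_comp_sub|exact: tame_comp_sub|].
by move=> y; exact: uv.
Qed.

Lemma lin_shift u (r x : R) : linop (fun s => u (s - r)) x = linop u (x - r).
Proof. by rewrite /linop; congr (_ * _); apply: eq_kmean => y; congr u; ring. Qed.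

Lemma lin_expR l x :
  linop (fun s => expR (l * s)) x = (1 + d) * moment k l * expR (- l * c) * expR (l * x).
Proof.
rewrite /linop -!mulrA; congr (_ * _).
rewrite -expRD mulrC -(mom_opp hk) /moment -(kmeanZ hk _ (tame_expR (- l))).
by apply: eq_kmean => y; rewrite -expRD; congr expR; ring.
Qed.

Variable lam : R.
Hypothesis lam0 : 0 < lam.
Hypothesis mom_lam : (1 + d) * moment k lam = expR (lam * c).
Hypothesis mean_lam : kmean k (fun y => y * expR (lam * y)) = c * moment k lam.

(** Resonance at the critical speed: the tilted kernel has mean [c], so besides
    [exp (lam s)] also [s exp (lam s)] is a fixed point. *)
Lemma lin_id_expR x : linop (fun s => s * expR (lam * s)) x = x * expR (lam * x).
Proof.
rewrite /linop.
have te : tame (fun y => y * expR (lam * y)) by apply: tameM; [exact: tame_id|exact: tame_expR].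
have tg : tame (fun s => s * expR (lam * s)) by [].
rewrite -(kmean_oppr hk (tame_comp_sub _ tg)).
have -> : kmean k (fun y => (x - c - - y) * expR (lam * (x - c - - y))) =
  kmean k (fun y => expR (lam * (x - c)) * ((x - c) * expR (lam * y) + y * expR (lam * y))).
  apply: eq_kmean => y.
  rewrite -mulrDl mulrCA -expRD opprK; congr (_ * expR _); ring.
have tce := tameZ (x - c) (tame_expR lam).
rewrite (kmeanZ hk _ (tameD tce te)) (kmeanD hk tce te) (kmeanZ hk _ (tame_expR lam)).
rewrite mean_lam -/(moment k lam) -mulrDl subrK.
have -> : (1 + d) * (expR (lam * (x - c)) * (x * moment k lam)) =
  x * (expR (lam * (x - c)) * ((1 + d) * moment k lam)) by ring.
by rewrite mom_lam -expRD; congr (_ * expR _); ring.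
Qed.

(** The exponentials needed have exponents [3 lam / 4], [lam], [3 lam / 2] and
    [2 lam], that is, they are the powers 3, 4, 6 and 8 of this one; inequalities
    between them become polynomial. *)
Definition qexp (s : R) : R := expR (lam / 4 * s).

Definition eigval (m : nat) : R :=
  (1 + d) * moment k (m%:R * (lam / 4)) * expR (- (m%:R * (lam / 4)) * c).

Lemma q_gt0 s : 0 < qexp s. Proof. exact: expR_gt0. Qed.

Lemma qX m s : qexp s ^+ m = expR (m%:R * (lam / 4) * s).
Proof. by rewrite /qexp -expRM_natl mulrA. Qed.

Lemma tame_qX m : tame (fun s => qexp s ^+ m).
Proof. by under eq_fun do rewrite qX; exact: tame_expR. Qed.

Lemma lin_qX m x : linop (fun s => qexp s ^+ m) x = eigval m * qexp x ^+ m.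
Proof. by under [in LHS]eq_fun do rewrite qX; rewrite lin_expR qX. Qed.

Lemma eig4 : eigval 4 = 1.
Proof.
rewrite /eigval (_ : 4%:R * (lam / 4) = lam); last by field.
by rewrite mom_lam mulNr mulrC -expRD addNr expR0.
Qed.

Lemma q4E s : qexp s ^+ 4 = expR (lam * s).
Proof.
rewrite qX; have -> : 4%:R * (lam / 4) = lam by field.
by [].
Qed.

Lemma lin_idq4 x : linop (fun s => s * qexp s ^+ 4) x = x * qexp x ^+ 4.
Proof. by under [in LHS]eq_fun do rewrite q4E; rewrite lin_id_expR q4E. Qed.

Lemma tame_idq4 : tame (fun s => s * qexp s ^+ 4).
Proof. by apply: tameM; [exact: tame_id|exact: tame_qX]. Qed.

(** All the barriers have this shape: the two fixed points of the linear operator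
    plus two corrections, one to gain strictness on the left and one to fix the
    sign on the right. *)
Definition expcomb (b0 b1 b2 b3 s : R) : R :=
  b0 * qexp s ^+ 4 - b1 * (s * qexp s ^+ 4) + b2 * qexp s ^+ 6 + b3 * qexp s ^+ 8.

Lemma tame_comb b0 b1 b2 b3 : tame (expcomb b0 b1 b2 b3).
Proof.
rewrite /expcomb; apply: tameD; last exact/tameZ/tame_qX.
apply: tameD; last exact/tameZ/tame_qX.
by apply: tameB; [exact/tameZ/tame_qX|exact/tameZ/tame_idq4].
Qed.

Lemma lin_comb b0 b1 b2 b3 x : linop (expcomb b0 b1 b2 b3) x =
  expcomb b0 b1 (b2 * eigval 6) (b3 * eigval 8) x.
Proof.
have t4 := tameZ b0 (tame_qX 4); have t5 := tameZ b1 tame_idq4.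
have t6 := tameZ b2 (tame_qX 6); have t8 := tameZ b3 (tame_qX 8).
rewrite /expcomb (linD x (tameD (tameB t4 t5) t6) t8) (linD x (tameB t4 t5) t6).
rewrite (linB x t4 t5) !linZ ?lin_qX ?lin_idq4 ?eig4 ?mul1r ?mulrA//.
all: by [exact: tame_qX|exact: tame_idq4].
Qed.

Lemma q_ge s : 1 + lam / 4 * s <= qexp s. Proof. exact: expR_ge1Dx. Qed.

(** [- mu s <= exp (- mu s)] with [mu = lam / 4], cleared of the inverse: the linear
    factor [- s] costs at most one power of [qexp]. *)
Lemma q_inv_ge s : - (lam / 4) * s * qexp s <= 1.
Proof.
have := expR_ge1Dx (- (lam / 4 * s)); rewrite expRN -/(qexp s) => h.
have q0 := q_gt0 s.
have : (1 + - (lam / 4 * s)) * qexp s <= 1.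
  by rewrite -ler_pdivlMr// mul1r.
nra.
Qed.

Lemma q_le1 s : s <= 0 -> qexp s <= 1.
Proof. by move=> s0; rewrite -expR0 ler_expR mulr_ge0_le0// divr_ge0// ltW. Qed.

Lemma q_ge1 s : 0 <= s -> 1 <= qexp s.
Proof. by move=> s0; rewrite -expR0 ler_expR mulr_ge0// divr_ge0// ltW. Qed.

Lemma q_le s t : s <= t -> qexp s <= qexp t.
Proof. by move=> st; rewrite ler_expR ler_wpM2l// divr_ge0// ltW. Qed.

Lemma qD s t : qexp (s + t) = qexp s * qexp t.
Proof. by rewrite /qexp mulrDr expRD. Qed.

Lemma q_small e : 0 < e -> exists X, 0 <= X /\ forall s, s <= - X -> qexp s <= e.
Proof.
move=> e0; have l0 : 0 < lam / 4 by rewrite divr_gt0.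
exists (4 / lam / e); split; first by rewrite !divr_ge0// ltW.
move=> s sX; apply: le_trans (q_le sX) _.
have := q_inv_ge (- (4 / lam / e)).
have -> : - (lam / 4) * - (4 / lam / e) = e^-1 by field; rewrite !gt_eqF.
by rewrite ler_pdivrMl// mulr1.
Qed.

End Operator.

(** * A Liouville theorem for the linear operator *)

Section Liouville.
Variable R : realType.
Variable k : R -> R.
Hypothesis hk : dispersal_kernel k.
Variables (d c : R).
Hypothesis d0 : 0 < d.
Variable lam : R.
Hypothesis lam0 : 0 < lam.
Hypothesis mom_lam : (1 + d) * moment k lam = expR (lam * c).
Hypothesis mean_lam : kmean k (fun y => y * expR (lam * y)) = c * moment k lam.
Hypothesis eig6 : 1 < eigval k d c lam 6.

Notation q := (qexp lam).
Notation lin := (linop k d c).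
Notation comb := (expcomb lam).
Notation eig := (eigval k d c lam).

Lemma combE b0 b1 b2 b3 s :
  comb b0 b1 b2 b3 s = q s ^+ 4 * (b0 - b1 * s + b2 * q s ^+ 2 + b3 * q s ^+ 4).
Proof. by rewrite /expcomb; ring. Qed.

Lemma eig_ge0 m : 0 <= eig m.
Proof.
have h := mom_ge1 hk (m%:R * (lam / 4)).
apply: mulr_ge0; last exact: expR_ge0.
by apply: mulr_ge0; [rewrite addr_ge0// ltW|lra].
Qed.

Definition barrier_coef : R := 1 + 4 / lam.
(** A non-negative function that grows like [- s] relative to [exp (lam s)] at
    minus infinity and is strictly superharmonic there.  No such function exists
    that is superharmonic on the whole line, because the tilted random walk is
    recurrent. *)
Definition barrier := comb 1 1 (- 1) barrier_coef.

Lemma Cb_ge1 : 1 <= barrier_coef.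
Proof. by rewrite lerDl divr_ge0// ltW. Qed.

Lemma tame_barrier : tame barrier. Proof. exact: tame_comb. Qed.

Lemma barrier_ge s : Num.max 0 (- s) * q s ^+ 4 <= barrier s.
Proof.
rewrite /barrier combE mulrC ler_pM2l ?exprn_gt0 ?q_gt0//.
have q0 := q_gt0 lam s; have C1 := Cb_ge1.
have [s0|s0] := lerP s 0.
  have q1 := q_le1 lam0 s0; rewrite max_r ?oppr_ge0//.
  have h2 : q s ^+ 2 <= 1 by rewrite exprn_ile1// ltW.
  have h4 : 0 <= barrier_coef * q s ^+ 4 by rewrite mulr_ge0 ?exprn_ge0 ?ltW//; lra.
  by lra.
have q1 := q_ge1 lam0 (ltW s0); rewrite max_l ?oppr_le0 ?ltW//.
have h2 : q s ^+ 2 <= q s ^+ 4 by rewrite ler_weXn2l.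
have h1 : q s <= q s ^+ 4 by rewrite -[leLHS]expr1 ler_weXn2l.
have h3 : s <= 4 / lam * q s.
  have := q_ge lam s; have l0 := lam0.
  have : 0 < 4 / lam by rewrite divr_gt0.
  move=> h5 h6; have : 4 / lam * (1 + lam / 4 * s) <= 4 / lam * q s by rewrite ler_pM2l.
  have -> : 4 / lam * (1 + lam / 4 * s) = 4 / lam + s by field; rewrite gt_eqF.
  by lra.
have h6 : 4 / lam * q s <= 4 / lam * q s ^+ 4 by rewrite ler_wpM2l// divr_ge0// ltW.
by rewrite /barrier_coef; lra.
Qed.

Lemma barrier_ge0 s : 0 <= barrier s.
Proof.
apply: le_trans (barrier_ge s); rewrite mulr_ge0 ?le_max ?lexx//.
by rewrite exprn_ge0// ltW// q_gt0.
Qed.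

(** The [qexp ^ 6] term gains a fixed proportion because its eigenvalue exceeds
    [1]; the [qexp ^ 8] term loses, but is negligible far to the left. *)
Lemma lin_barrier : exists X, 0 <= X /\ forall s, s <= - X ->
  lin barrier s <= barrier s - (eig 6 - 1) / 2 * q s ^+ 6.
Proof.
have C1 := Cb_ge1; have N8 := eig_ge0 8; have N6 := eig6.
have CN : 0 < 2 * (barrier_coef * eig 8 + 1) by have := mulr_ge0 (le_trans ler01 C1) N8; lra.
pose e := Num.min 1 ((eig 6 - 1) / (2 * (barrier_coef * eig 8 + 1))).
have e0 : 0 < e by rewrite lt_min ltr01 divr_gt0//; lra.
have [X [X0 HX]] := q_small lam0 e0; exists X; split=> // s sX.
have qe := HX _ sX; have q0 := q_gt0 lam s.
have q1 : q s <= 1 by rewrite (le_trans qe)// ge_min lexx.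
rewrite /barrier (lin_comb hk mom_lam mean_lam) /expcomb.
have h : (barrier_coef * eig 8 + 1) * q s ^+ 2 <= (eig 6 - 1) / 2.
  have h1 : q s ^+ 2 <= (eig 6 - 1) / (2 * (barrier_coef * eig 8 + 1)).
    rewrite (le_trans _ (le_trans qe _)) ?ge_min ?lexx ?orbT//.
    by rewrite expr2 ler_piMl// ltW.
  rewrite -(ler_pM2l CN) in h1.
  move: h1; rewrite [X in _ <= X]mulrCA divff ?gt_eqF// mulr1; lra.
have h6 : 0 < q s ^+ 6 by rewrite exprn_gt0.
have h7 : ((barrier_coef * eig 8 + 1) * q s ^+ 2) * q s ^+ 6 <= (eig 6 - 1) / 2 * q s ^+ 6.
  by rewrite ler_pM2r.
have h8 : 0 <= q s ^+ 8 by rewrite exprn_ge0// ltW.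
have h9 : 0 <= barrier_coef * q s ^+ 8 by rewrite mulr_ge0//; lra.
have h10 : ((barrier_coef * eig 8 + 1) * q s ^+ 2) * q s ^+ 6 = barrier_coef * eig 8 * q s ^+ 8 + q s ^+ 8 by ring.
by lra.
Qed.

Lemma tame_shift (g : R -> R) (x : R) : tame g -> tame (fun y => g (y - x)).
Proof.
move=> /tame_comp_oppr/(tame_comp_sub x).
by congr tame; apply/funext => y; congr g; ring.
Qed.

Lemma qN s : q (- s) = (q s)^-1.
Proof. by rewrite /qexp mulrN expRN. Qed.

(** A maximum principle with the barrier placed at [r].  To the right of [r - X]
    the bound [D <= 1] makes [D / exp (lam s)] small; to the left, the supremum
    of [D / exp (lam s)] minus a small multiple of the barrier cannot exceed that
    value, since it would be nearly attained where the barrier is strictly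
    superharmonic.  Let the multiple tend to zero, then [r] to infinity. *)
Lemma liouville (D : R -> R) (C0 : R) : tame D ->
  (forall s, D s <= 1) -> (forall s, D s <= C0 * q s ^+ 4) ->
  (forall s, D s <= lin D s) -> forall s, D s <= 0.
Proof.
move=> tD D1 DC DL.
have [X [X0 HX]] := lin_barrier.
have l0 := lam0.
have q4 s : 0 < q s ^+ 4 by rewrite exprn_gt0// q_gt0.
have key (r e : R) : 0 < e -> forall s,
    D s <= (q (r - X) ^+ 4)^-1 * q s ^+ 4 + e * barrier (s - r).
  move=> e0.
  pose sig := (q (r - X) ^+ 4)^-1.
  pose Dr s := D s - e * barrier (s - r).
  pose V s := Dr s / q s ^+ 4.
  have DV s : Dr s = V s * q s ^+ 4 by rewrite /V divfK// gt_eqF.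
  have tb : tame (fun s => barrier (s - r)) by apply: tame_shift; exact: tame_barrier.
  have tDr : tame Dr by apply: tameB => //; exact: tameZ.
  suff VS s : V s <= sig.
    by move=> s; have := VS s; rewrite -(ler_pM2r (q4 s)) -DV /Dr -/sig; lra.
  rewrite leNgt; apply/negP => Vs.
  have Vub t : V t <= C0.
    rewrite /V ler_pdivrMr//; apply: le_trans (DC t).
    by rewrite lerBlDr lerDl mulr_ge0 ?(ltW e0)// barrier_ge0.
  have hs : has_sup (range V) by split; [exists (V s), s|exists C0 => _ [t _ <-]].
  pose beta := sup (range V).
  have Vb t : V t <= beta by apply: ub_le_sup; [case: hs|exists t].
  have sig0 : 0 < sig by rewrite invr_gt0.
  (* to the left of [smin] the barrier exceeds [D], so [V] is negative there *)
  pose smin := r - C0 * q r ^+ 4 / e.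
  (* the gain of the barrier at [smin], the least one on the relevant interval *)
  pose tau := e * ((eig 6 - 1) / 2 * q (smin - r) ^+ 2 / q r ^+ 4).
  have g0 : 0 < (eig 6 - 1) / 2 by have := eig6; lra.
  have tau0 : 0 < tau.
    by rewrite mulr_gt0// divr_gt0// mulr_gt0// exprn_gt0// q_gt0.
  have m0 : 0 < Num.min tau (beta - sig).
    by rewrite lt_min tau0 subr_gt0; exact: lt_le_trans (Vb s).
  have [_ [t _ <-] ht] := sup_adherent m0 hs.
  have ht1 : beta - tau < V t.
    by apply: le_lt_trans ht; rewrite lerD2l lerN2 ge_min lexx.
  have ht2 : sig < V t.
    apply: le_lt_trans ht; rewrite -/beta.
    have : Num.min tau (beta - sig) <= beta - sig by rewrite ge_min lexx orbT.
    by lra.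
  have tX : t - r <= - X.
    rewrite leNgt; apply/negP => tX; move: ht2; apply/negP; rewrite -leNgt.
    rewrite /V ler_pdivrMr//; apply: (@le_trans _ _ 1).
      apply: le_trans (D1 t).
      by rewrite lerBlDr lerDl mulr_ge0 ?(ltW e0)// barrier_ge0.
    rewrite /sig mulrC ler_pdivlMr// mul1r.
    by apply: lerXn2r; rewrite ?nnegrE ?(ltW (q_gt0 _ _))// q_le//; lra.
  have tmin : smin <= t.
    have h1 : 0 < Dr t by rewrite DV mulr_gt0// (lt_trans sig0).
    have h2 : e * (- (t - r) * q (t - r) ^+ 4) <= C0 * q t ^+ 4.
      apply: (@le_trans _ _ (e * barrier (t - r))).
        rewrite ler_pM2l//; apply: le_trans (barrier_ge _).
        by rewrite ler_pM2r// le_max lexx orbT.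
      by apply: le_trans (DC t); rewrite /Dr in h1; lra.
    have qt : q t = q (t - r) * q r by rewrite -qD; congr q; ring.
    have {}h2 : q (t - r) ^+ 4 * (e * (- (t - r))) <= q (t - r) ^+ 4 * (C0 * q r ^+ 4).
      by rewrite qt exprMn in h2; lra.
    rewrite ler_pM2l// in h2.
    have h3 : - (t - r) <= C0 * q r ^+ 4 / e by rewrite ler_pdivlMr// mulrC.
    by rewrite /smin; lra.
  have LD : Dr t <= lin Dr t - e * ((eig 6 - 1) / 2 * q (t - r) ^+ 6).
    rewrite /Dr (linB hk _ _ _ tD (tameZ e tb)) (linZ hk _ _ _ _ tb) lin_shift.
    have := HX _ tX; rewrite -(ler_pM2l e0) => h.
    by have := DL t; lra.
  have LB : lin Dr t <= beta * q t ^+ 4.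
    rewrite -(mul1r (q t ^+ 4)) -{1}(eig4 mom_lam) -(lin_qX hk) -(linZ hk _ _ _ _ (tame_qX _ _)).
    apply: (lin_le hk _ d0) => //; first exact: tameZ (tame_qX _ _).
    by move=> y; rewrite DV ler_pM2r.
  have : V t <= beta - tau.
    rewrite /V ler_pdivrMr// mulrBl; apply: (le_trans LD).
    apply: lerB => //; rewrite /tau.
    have qt : q t = q (t - r) * q r by rewrite -qD; congr q; ring.
    have h1 : q (smin - r) <= q (t - r) by apply: q_le => //; lra.
    have h2 : q (smin - r) ^+ 2 <= q (t - r) ^+ 2.
      by apply: lerXn2r; rewrite ?nnegrE ?(ltW (q_gt0 _ _)).
    have -> : e * ((eig 6 - 1) / 2 * q (smin - r) ^+ 2 / q r ^+ 4) * q t ^+ 4 =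
      e * ((eig 6 - 1) / 2) * q (t - r) ^+ 4 * q (smin - r) ^+ 2.
      by rewrite qt exprMn; field; rewrite gt_eqF// q_gt0.
    have -> : e * ((eig 6 - 1) / 2 * q (t - r) ^+ 6) =
      e * ((eig 6 - 1) / 2) * q (t - r) ^+ 4 * q (t - r) ^+ 2 by ring.
    have hp : 0 < e * ((eig 6 - 1) / 2) * q (t - r) ^+ 4.
      by apply: mulr_gt0 => //; exact: mulr_gt0.
    by rewrite ler_pM2l.
  by lra.
have key2 r s : D s <= (q (r - X) ^+ 4)^-1 * q s ^+ 4.
  apply/ler_addgt0Pr => e e0.
  have bp : 0 < barrier (s - r) + 1 by have := barrier_ge0 (s - r); lra.
  have := key r (e / (barrier (s - r) + 1)) (divr_gt0 e0 bp) s.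
  move=> h; apply: le_trans h _; rewrite lerD2l -mulrA ler_piMr ?(ltW e0)//.
  by rewrite mulrC ler_pdivrMr// mul1r; lra.
move=> s; apply/ler_addgt0Pr => e e0; rewrite add0r.
have e'0 : 0 < Num.min 1 (e / q s ^+ 4) by rewrite lt_min ltr01 divr_gt0.
have [Y [Y0 HY]] := q_small l0 e'0.
have := HY (- Y) (lexx _); rewrite le_min => /andP[qY1 qYe].
apply: (le_trans (key2 (X + Y) s)).
rewrite -ler_pdivlMr// (_ : X + Y - X = Y); last by ring.
rewrite -exprVn -qN; apply: le_trans qYe.
by rewrite -[leRHS]expr1 ler_wiXn2l// ltW// q_gt0.
Qed.

End Liouville.

(** * The growth function *)

Section Growth.
Variable R : realType.
Variables (d a : R).
Hypothesis d0 : 0 < d.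
Hypothesis ha : 0 <= a < 1.
Implicit Types u v : R.

Definition growth u v : R := (1 + d) * u / (1 + d * (u + a * v)).

Let a0 : 0 <= a. Proof. by case/andP: ha. Qed.
Let a1 : a < 1. Proof. by case/andP: ha. Qed.

Lemma den_ge1 u v : 0 <= u -> 0 <= v -> 1 <= 1 + d * (u + a * v).
Proof. by move=> u0 v0; rewrite lerDl mulr_ge0 ?addr_ge0 ?mulr_ge0 ?(ltW d0). Qed.

Lemma den_gt0 u v : 0 <= u -> 0 <= v -> 0 < 1 + d * (u + a * v).
Proof. by move=> u0 v0; apply: lt_le_trans (den_ge1 u0 v0). Qed.

Lemma growth_ge0 u v : 0 <= u -> 0 <= v -> 0 <= growth u v.
Proof.
move=> u0 v0; rewrite /growth divr_ge0//; last exact/ltW/den_gt0.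
by rewrite mulr_ge0// addr_ge0// ltW.
Qed.

Lemma growth_gt0 u v : 0 < u -> 0 <= v -> 0 < growth u v.
Proof.
move=> u0 v0; rewrite /growth divr_gt0//; last by apply: den_gt0 => //; exact: ltW.
by rewrite mulr_gt0// addr_gt0.
Qed.

Lemma growth_le1 u v : 0 <= u <= 1 -> 0 <= v -> growth u v <= 1.
Proof.
move=> /andP[u0 u1] v0; rewrite /growth ler_pdivrMr ?den_gt0// mul1r.
have := mulr_ge0 (ltW d0) (mulr_ge0 a0 v0); lra.
Qed.

Lemma growth_le_lin u v : 0 <= u -> 0 <= v -> growth u v <= (1 + d) * u.
Proof.
move=> u0 v0; rewrite /growth ler_pdivrMr ?den_gt0// ler_peMr ?den_ge1//.
by rewrite mulr_ge0// addr_ge0// ltW.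
Qed.

Lemma growth_le u u' v v' : 0 <= u -> u <= u' -> 0 <= v' -> v' <= v ->
  growth u v <= growth u' v'.
Proof.
move=> u0 uu v0 vv; have u'0 := le_trans u0 uu; have v'0 := le_trans v0 vv.
rewrite /growth ler_pdivrMr ?den_gt0// mulrAC ler_pdivlMr ?den_gt0//.
rewrite -!mulrA ler_pM2l ?addr_gt0//.
have h1 : 0 <= (d * a) * (u' * v - u * v').
  rewrite mulr_ge0// ?mulr_ge0 ?(ltW d0)// subr_ge0; exact: ler_pM.
lra.
Qed.

Lemma growth_lower u v : 0 <= u -> 0 <= v ->
  (1 + d) * (u - d * (u * (u + a * v))) <= growth u v.
Proof.
move=> u0 v0; rewrite /growth ler_pdivlMr ?den_gt0// -!mulrA ler_pM2l ?addr_gt0//.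
set w := u + a * v; have w0 : 0 <= w by rewrite addr_ge0// mulr_ge0.
have : 0 <= u * (d * w) ^+ 2 by rewrite mulr_ge0// sqr_ge0.
lra.
Qed.

(** Along a segment the two partial derivatives of the growth function have
    absolute values adding up to at most [1 + d], thanks to [a <= 1]. *)
Lemma growth_diff u l u' l' M : 0 <= l -> l <= u -> 0 <= l' -> l' <= u' ->
  u - l <= M -> u' - l' <= M -> growth u l' - growth l u' <= (1 + d) * M.
Proof.
move=> l0 lu l'0 lu' uM uM'.
have u0 := le_trans l0 lu; have u'0 := le_trans l'0 lu'.
have M0 : 0 <= M by lra.
rewrite /growth -!mulrA -mulrBr ler_pM2l ?addr_gt0//.
set P := 1 + d * (u + a * l'); set Q := 1 + d * (l + a * u').
have P1 : 1 <= P by exact: den_ge1.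
have Q1 : 1 <= Q by exact: den_ge1.
have P0 : 0 < P by lra.
have Q0 : 0 < Q by lra.
have -> : u / P - l / Q = (u * Q - l * P) / (P * Q) by field; rewrite !gt_eqF.
rewrite ler_pdivrMr ?mulr_gt0//.
apply: (@le_trans _ _ (M * P)).
  have h1 : u * (u' - l') <= u * M by rewrite ler_wpM2l.
  have h2 : l' * (u - l) <= l' * M by rewrite ler_wpM2l.
  have da : 0 <= d * a by rewrite mulr_ge0// ltW.
  have h3 : d * a * (u * (u' - l') + l' * (u - l)) <= d * a * (u * M + l' * M).
    by rewrite ler_wpM2l// lerD.
  have h4 : 0 <= M * (d * ((1 - a) * u)).
    by rewrite mulr_ge0// mulr_ge0 ?(ltW d0)// mulr_ge0// subr_ge0 ltW.
  have -> : u * Q - l * P = (u - l) + d * a * (u * (u' - l') + l' * (u - l)).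
    by rewrite /P /Q; ring.
  have -> : M * P = M + d * a * (u * M + l' * M) + M * (d * ((1 - a) * u)).
    by rewrite /P; ring.
  by lra.
by rewrite ler_wpM2l// ler_peMr// ltW.
Qed.

(** The denominator is at least [1], so the inverse may be replaced by the
    continuous function [1 / max (x, 1)]. *)
Lemma measurable_gr (f g : R -> R) : measurable_fun setT f -> measurable_fun setT g ->
  (forall s, 0 <= f s) -> (forall s, 0 <= g s) ->
  measurable_fun setT (fun s => growth (f s) (g s)).
Proof.
move=> mf mg f0 g0.
pose r (x : R) := (Num.max x 1)^-1.
have cr : continuous r.
  move=> x; apply: cvgV; first by rewrite gt_eqF// lt_max ltr01 orbT.
  by apply: continuous_max; [exact: cvg_id|exact: cvg_cst].
have -> : (fun s => growth (f s) (g s)) =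
  (fun s => (1 + d) * f s * r (1 + d * (f s + a * g s))).
  apply/funext => s; rewrite /growth /r; congr (_ * _^-1).
  by rewrite max_l// den_ge1.
apply: measurable_funM; first exact: measurable_funM.
apply: measurableT_comp; first exact: continuous_measurable_fun.
apply: measurable_funD => //; apply: measurable_funM => //.
by apply: measurable_funD => //; exact: measurable_funM.
Qed.

Lemma continuous_gr (T : topologicalType) (F : set_system T) (FF : Filter F)
    (f g : T -> R) (x y : R) : 0 <= x -> 0 <= y ->
  f s @[s --> F] --> x -> g s @[s --> F] --> y ->
  growth (f s) (g s) @[s --> F] --> growth x y.
Proof.
move=> x0 y0 fx gy; apply: cvgM; first exact: cvgMr.
apply: cvgV; first by rewrite gt_eqF// den_gt0.
by apply: cvgD; [exact: cvg_cst|apply: cvgMr; apply: cvgD => //; exact: cvgMr].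
Qed.

End Growth.

(** * The nonlinear operator *)

Section Step.
Variable R : realType.
Variable k : R -> R.
Hypothesis hk : dispersal_kernel k.
Variables (d a c : R).
Hypothesis d0 : 0 < d.
Hypothesis ha : 0 <= a < 1.
Implicit Types u v : R -> R.

Notation gr := (growth d a).

(** The functions on which the nonlinear operator acts. *)
Definition unit_profile u := measurable_fun setT u /\ forall s, 0 <= u s <= 1.

Definition delay_growth u v (s : R) : R := gr (u s) (v (s - c)).

(** Traveling waves are the profiles with [phi = wave_step phi phi]; the two
    arguments are kept apart because the operator increases in the first and
    decreases in the second. *)
Definition wave_step u v x : R := kmean k (fun y => delay_growth u v (x - c - y)).

Lemma grow01 u v s : unit_profile u -> unit_profile v -> 0 <= delay_growth u v s <= 1.
Proof.
move=> [_ u01] [_ v01]; have /andP[v0 _] := v01 (s - c); have /andP[u0 u1] := u01 s.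
by rewrite /delay_growth growth_ge0//= growth_le1// u0.
Qed.

Lemma measurable_grow u v : unit_profile u -> unit_profile v -> measurable_fun setT (delay_growth u v).
Proof.
move=> [mu u01] [mv v01]; apply: measurable_gr => //.
- apply: measurableT_comp => //.
  by apply: measurable_funB; [exact: measurable_id|exact: measurable_cst].
- by move=> s; case/andP: (u01 s).
- by move=> s; case/andP: (v01 (s - c)).
Qed.

Lemma tame_profile u : unit_profile u -> tame u.
Proof.
move=> [mu u01]; apply: (@tame_bounded _ _ 1) => // y.
by have /andP[? ?] := u01 y; rewrite ger0_norm.
Qed.

Lemma profile_grow u v : unit_profile u -> unit_profile v -> unit_profile (delay_growth u v).
Proof. by move=> du dv; split; [exact: measurable_grow|move=> s; exact: grow01]. Qed.

Lemma tame_grow u v : unit_profile u -> unit_profile v -> tame (delay_growth u v).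
Proof. by move=> du dv; apply/tame_profile/profile_grow. Qed.

Lemma step01 u v x : unit_profile u -> unit_profile v -> 0 <= wave_step u v x <= 1.
Proof.
move=> du dv; apply/andP; split.
  by apply: (kmean_ge0 hk) => y; case/andP: (grow01 (x - c - y) du dv).
rewrite -(kmean_cst hk 1); apply: (kmean_le hk).
- by apply: tame_comp_sub; exact: tame_grow.
- exact: tame_cst.
by move=> y; case/andP: (grow01 (x - c - y) du dv).
Qed.

Lemma grow_le u u' v v' s : unit_profile u -> unit_profile v' ->
  (forall s, u s <= u' s) -> (forall s, v' s <= v s) ->
  delay_growth u v s <= delay_growth u' v' s.
Proof.
move=> [_ u01] [_ v01] uu vv; apply: growth_le => //; first by case/andP: (u01 s).
by case/andP: (v01 (s - c)).
Qed.

Lemma step_le u u' v v' x : unit_profile u -> unit_profile v -> unit_profile u' -> unit_profile v' ->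
  (forall s, u s <= u' s) -> (forall s, v' s <= v s) ->
  wave_step u v x <= wave_step u' v' x.
Proof.
move=> du dv du' dv' uu vv; apply: (kmean_le hk).
- by apply: tame_comp_sub; exact: tame_grow.
- by apply: tame_comp_sub; exact: tame_grow.
by move=> y; exact: grow_le.
Qed.

Lemma step_le_lin u v x : unit_profile u -> unit_profile v -> wave_step u v x <= linop k d c u x.
Proof.
move=> du dv; rewrite /linop -(kmeanZ hk _ (tame_comp_sub _ (tame_profile du))).
apply: (kmean_le hk).
- by apply: tame_comp_sub; exact: tame_grow.
- by apply: tameZ; apply: tame_comp_sub; exact: tame_profile.
move=> y; apply: growth_le_lin => //; first by case/andP: (du.2 (x - c - y)).
by case/andP: (dv.2 (x - c - y - c)).
Qed.

Lemma continuous_grow u v : unit_profile u -> unit_profile v ->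
  continuous u -> continuous v -> continuous (delay_growth u v).
Proof.
move=> du dv cu cv s.
apply: (@continuous_gr _ d a d0 ha _ (nbhs s) (nbhs_filter s) u (fun s => v (s - c))).
- by case/andP: (du.2 s).
- by case/andP: (dv.2 (s - c)).
- exact: cu.
- apply: (@cvg_comp _ _ _ (fun s => s - c) v _ (nbhs (s - c))); last exact: cv.
  by apply: cvgB; [exact: cvg_id|exact: cvg_cst].
Qed.

Lemma continuous_step u v : unit_profile u -> unit_profile v ->
  continuous u -> continuous v -> continuous (wave_step u v).
Proof.
move=> du dv cu cv x.
apply: (@kmean_continuous_at _ _ hk (fun x y => delay_growth u v (x - c - y)) (cst 1)).
- by move=> t; have [] := tame_comp_sub (t - c) (tame_grow du dv).
- exact: tame_cst.
- near=> t => y; have /andP[? ?] := grow01 (t - c - y) du dv.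
  by rewrite ger0_norm.
- move=> y; apply: (@cvg_comp _ _ _ (fun s => s - c - y) (delay_growth u v) _
    (nbhs (x - c - y))); last exact: continuous_grow.
  by apply: cvgB; [apply: cvgB; [exact: cvg_id|exact: cvg_cst]|exact: cvg_cst].
Unshelve. all: by end_near. Qed.

Lemma step_cvg (u_ v_ : nat -> R -> R) u v x :
  (forall n, unit_profile (u_ n)) -> (forall n, unit_profile (v_ n)) ->
  unit_profile u -> unit_profile v ->
  (forall s, u_ n s @[n --> \oo] --> u s) -> (forall s, v_ n s @[n --> \oo] --> v s) ->
  wave_step (u_ n) (v_ n) x @[n --> \oo] --> wave_step u v x.
Proof.
move=> du dv du' dv' uu vv.
apply: (kmean_cvg hk _ (tame_cst 1)).
- by move=> n; have [] := tame_comp_sub (x - c) (tame_grow (du n) (dv n)).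
- move=> n y; have /andP[? ?] := grow01 (x - c - y) (du n) (dv n).
  by rewrite ger0_norm.
- move=> y; apply: (@continuous_gr _ d a d0 ha _ \oo eventually_filter (fun n => u_ n (x - c - y))
    (fun n => v_ n (x - c - y - c))).
  + by case/andP: (du'.2 (x - c - y)).
  + by case/andP: (dv'.2 (x - c - y - c)).
  + exact: uu.
  + exact: vv.
Qed.

Lemma profile_step u v : unit_profile u -> unit_profile v -> continuous u -> continuous v ->
  unit_profile (wave_step u v).
Proof.
move=> du dv cu cv; split; last by move=> s; exact: step01.
by apply: continuous_measurable_fun; exact: continuous_step.
Qed.

End Step.

(** * Super- and subsolution at the critical speed *)

Section Sandwich.
Variable R : realType.
Variable k : R -> R.
Hypothesis hk : dispersal_kernel k.
Variables (d a c : R).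
Hypothesis d0 : 0 < d.
Hypothesis ha : 0 <= a < 1.
Hypothesis c0 : 0 < c.
Variable lam : R.
Hypothesis lam0 : 0 < lam.
Hypothesis mom_lam : (1 + d) * moment k lam = expR (lam * c).
Hypothesis mean_lam : kmean k (fun y => y * expR (lam * y)) = c * moment k lam.
Hypothesis eig6 : 1 < eigval k d c lam 6.

Notation q := (qexp lam).
Notation lin := (linop k d c).
Notation comb := (expcomb lam).
Notation eig := (eigval k d c lam).
Notation step := (wave_step k d a c).
Notation Cb := (barrier_coef lam).

Let a0 : 0 <= a. Proof. by case/andP: ha. Qed.
Let q0 s : 0 < q s. Proof. exact: q_gt0. Qed.
Let qX0 s m : 0 < q s ^+ m. Proof. by rewrite exprn_gt0. Qed.

Lemma continuous_q : continuous q.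
Proof.
move=> s; apply: continuous_cvg; first exact: continuous_expR.
by apply: cvgMr; exact: cvg_id.
Qed.

Lemma continuous_qX m : continuous (fun s => q s ^+ m).
Proof.
move=> s; apply: (@cvg_comp _ _ _ q (fun t => t ^+ m) _ (nbhs (q s))).
  exact: continuous_q.
exact: exprn_continuous.
Qed.

Lemma continuous_comb b0 b1 b2 b3 : continuous (comb b0 b1 b2 b3).
Proof.
move=> s; rewrite /expcomb; apply: cvgD; last by apply: cvgMr; exact: continuous_qX.
apply: cvgD; last by apply: cvgMr; exact: continuous_qX.
apply: cvgB; first by apply: cvgMr; exact: continuous_qX.
by apply: cvgMr; apply: cvgM; [exact: cvg_id|exact: continuous_qX].
Qed.

Lemma continuous_profile (f : R -> R) : continuous f -> (forall s, 0 <= f s <= 1) ->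
  unit_profile f.
Proof. by move=> cf f01; split=> //; exact: continuous_measurable_fun. Qed.

(** The truncation at [1] is harmless because the growth function does not exceed
    [1] on [[0, 1]]; the untruncated function is a supersolution only far to
    the left, so the coefficient [A] is taken so large that it exceeds [1]
    elsewhere. *)
Lemma super_solution : exists up A C1, [/\ unit_profile up, continuous up, 1 <= A, 1 <= C1 &
  [/\ forall s, up s <= C1 * q s ^+ 3,
      forall s, up s <= comb A 1 (- 1) Cb s,
      forall s, comb A 1 (- 1) Cb s <= 1 -> up s = comb A 1 (- 1) Cb s,
      forall s, 1 <= comb A 1 (- 1) Cb s -> up s = 1 &
      forall v x, unit_profile v -> step up v x <= up x]].
Proof.
have [X [X0 HX]] := lin_barrier hk d0 lam0 mom_lam mean_lam eig6.
have l0 := lam0; have C1 := Cb_ge1 lam0.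
(* makes [(A - 1) exp (lam s) >= 1] for [s >= - X] *)
pose A := 1 + (q (- X) ^+ 4)^-1.
have A1 : 1 <= A by rewrite lerDl invr_ge0 ltW.
pose H := comb A 1 (- 1) Cb.
have HE s : H s = barrier lam s + (A - 1) * q s ^+ 4.
  by rewrite /H /barrier /expcomb; ring.
have Hge s : - X <= s -> 1 <= H s.
  move=> sX; have h' : q (- X) ^+ 4 <= q s ^+ 4.
    by apply: lerXn2r; rewrite ?nnegrE ?(ltW (q0 _))// q_le.
  have h : 1 <= (q (- X) ^+ 4)^-1 * q s ^+ 4 by rewrite ler_pdivlMl// mulr1.
  rewrite HE (_ : A - 1 = (q (- X) ^+ 4)^-1); last by rewrite /A; ring.
  by apply: le_trans h _; rewrite lerDr barrier_ge0.
have H0 s : 0 <= H s.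
  by rewrite HE addr_ge0 ?barrier_ge0// mulr_ge0 ?(ltW (qX0 _ _))//; lra.
pose up s := Num.min 1 (H s).
have upH s : up s <= H s by rewrite /up ge_min lexx orbT.
have up1 s : up s <= 1 by rewrite /up ge_min lexx.
have up0 s : 0 <= up s by rewrite /up le_min ler01 H0.
have cup : continuous up.
  by move=> s; apply: continuous_min; [exact: cvg_cst|exact: continuous_comb].
have dup : unit_profile up by apply: continuous_profile => // s; rewrite up0 up1.
pose K := A + Cb + 4 / lam.
have l4 : 0 < 4 / lam by rewrite divr_gt0.
have K1 : 1 <= K by rewrite /K; lra.
exists up, A, K; split=> //; split=> //.
- move=> s; have [s0|s0] := lerP s 0; last first.
    have q1 := q_ge1 lam0 (ltW s0).
    have : 1 <= q s ^+ 3 by rewrite exprn_ege1.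
    by move=> h; apply: (le_trans (up1 s)); rewrite mulr_ege1.
  apply: (le_trans (upH s)).
  have q1 := q_le1 lam0 s0.
  have h := q_inv_ge lam s.
  have h' : - s * q s <= 4 / lam.
    rewrite ler_pdivlMr//; lra.
  rewrite /H combE.
  have -> : q s ^+ 4 * (A - 1 * s + -1 * q s ^+ 2 + Cb * q s ^+ 4) =
    q s ^+ 3 * (A * q s + (- s * q s) - q s ^+ 3 + Cb * q s ^+ 5) by ring.
  rewrite mulrC ler_pM2r//.
  have : A * q s <= A * 1 by rewrite ler_wpM2l//; lra.
  have : Cb * q s ^+ 5 <= Cb * 1 by rewrite ler_wpM2l ?exprn_ile1 ?(ltW (q0 _))//; lra.
  by have := qX0 s 3; rewrite /K; lra.
- by move=> s h; rewrite /up min_r.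
- by move=> s h; rewrite /up min_l.
move=> v x dv; rewrite {2}/up le_min; apply/andP; split.
  by case/andP: (step01 hk c d0 ha x dup dv).
have [xX|xX] := lerP (- X) x.
  by apply: le_trans (Hge _ xX); case/andP: (step01 hk c d0 ha x dup dv).
apply: (le_trans (step_le_lin hk _ d0 ha _ dup dv)).
apply: (@le_trans _ _ (lin H x)).
  by apply: (lin_le hk _ d0) => //; [exact: tame_profile|exact: tame_comb].
have := HX x (ltW xX).
rewrite HE {1}/barrier (lin_comb hk mom_lam mean_lam) => h.
rewrite /H (lin_comb hk mom_lam mean_lam).
have : 0 <= (eig 6 - 1) / 2 * q x ^+ 6.
  by rewrite mulr_ge0 ?(ltW (qX0 _ _))//; have := eig6; lra.
rewrite /barrier /expcomb in h *; lra.
Qed.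

(** For the subsolution the quadratic loss of the growth function is at most a
    multiple of [qexp ^ 6], as both profiles are bounded by multiples of
    [qexp ^ 3]; the coefficient [B] of [qexp ^ 6] is chosen so that its gain
    under the linear operator pays for this loss.  The truncation at [0] takes
    effect to the right of [- Y], where the lower bound is trivial. *)
Lemma sandwich : exists up lo C0 C1,
 [/\ unit_profile up, unit_profile lo, continuous up, continuous lo & forall s, lo s <= up s] /\
 [/\ forall s, up s <= C1 * q s ^+ 3,
     forall s, up s - lo s <= C0 * q s ^+ 4,
     exists s0, forall s, s < s0 -> 0 < lo s,
     forall v x, unit_profile v -> step up v x <= up x &
     forall x, lo x <= step lo up x].
Proof.
have [up [A [C1 [dup cup A1 C11 [upq upH upE up1 stepup]]]]] := super_solution.
have l0 := lam0; have Cb1 := Cb_ge1 lam0.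
have N6 := eig6; have N8 := eig_ge0 hk c d0 lam 8.
pose K := d * (1 + a) * C1 ^+ 2.
have K0 : 0 <= K by rewrite mulr_ge0 ?sqr_ge0// mulr_ge0 ?addr_ge0 ?(ltW d0).
pose B := (K * eig 6 + 1) / (eig 6 - 1).
have B0 : 0 < B.
  by rewrite divr_gt0; [|have := mulr_ge0 K0 (ltW (lt_trans ltr01 N6)); lra|lra].
have BN : 0 < B * eig 8 + 1 by have := mulr_ge0 (ltW B0) N8; lra.
have m0 : 0 < Num.min 1 (Num.min (lam / 4) (B * eig 8 + 1)^-1).
  by rewrite !lt_min ltr01 divr_gt0// invr_gt0.
have [Y [Y0 HY]] := q_small l0 m0.
(* the coefficient [- B] of [qexp ^ 8] makes the function negative on [s >= 0] *)
pose low := comb (- (Y + B)) 1 B (- B).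
have lowE s : low s = q s ^+ 4 * (- s - Y - B + B * (q s ^+ 2 - q s ^+ 4)).
  by rewrite /low combE; ring.
have qq s : q s ^+ 2 - q s ^+ 4 <= 1 / 4.
  by have := sqr_ge0 (q s ^+ 2 - 1 / 2); lra.
have lows s : low s <= q s ^+ 4 * (- s - Y).
  rewrite lowE ler_pM2l//; have : B * (q s ^+ 2 - q s ^+ 4) <= B * (1 / 4) by rewrite ler_pM2l.
  by lra.
have low0 s : - Y <= s -> low s <= 0.
  by move=> sY; apply: (le_trans (lows s)); rewrite pmulr_rle0//; lra.
have low1 s : low s <= 1.
  have [sY|sY] := lerP (- Y) s; first exact: le_trans (low0 _ sY) ler01.
  have := HY s (ltW sY); rewrite !le_min => /and3P[q1 ql _].
  apply: (le_trans (lows s)).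
  have h := q_inv_ge lam s.
  have h2 : q s ^+ 3 <= lam / 4.
    by apply: le_trans ql; rewrite exprS ler_piMr ?(ltW (q0 _))// exprn_ile1 ?(ltW (q0 _)).
  have h3 : q s ^+ 4 * (- s - Y) <= q s ^+ 4 * - s by rewrite ler_pM2l//; lra.
  apply: (le_trans h3).
  have -> : q s ^+ 4 * - s = (- s * q s) * q s ^+ 3 by ring.
  have sq0 : 0 <= - s * q s by rewrite mulr_ge0 ?(ltW (q0 _))//; lra.
  apply: (@le_trans _ _ ((- s * q s) * (lam / 4))); last by lra.
  by rewrite ler_wpM2l.
have low_up s : low s <= up s.
  have [h|h] := leP (comb A 1 (- 1) Cb s) 1; last by rewrite (up1 _ (ltW h)).
  rewrite (upE _ h) combE; apply: (le_trans (lows s)); rewrite ler_pM2l//.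
  have [s0|s0] := lerP s 0.
    have h2 : q s ^+ 2 <= 1 by rewrite exprn_ile1 ?(ltW (q0 _))// q_le1.
    by have : 0 <= Cb * q s ^+ 4 by [rewrite mulr_ge0 ?(ltW (qX0 _ _))//; lra]; lra.
  have h2 : q s ^+ 2 <= q s ^+ 4 by rewrite ler_weXn2l// q_ge1// ltW.
  have : 1 * q s ^+ 4 <= Cb * q s ^+ 4 by rewrite ler_pM2r.
  have : 0 <= barrier lam s by exact: barrier_ge0.
  rewrite /barrier combE pmulr_rge0//; lra.
pose lo s := Num.max 0 (low s).
have lo_low s : low s <= lo s by rewrite /lo le_max lexx orbT.
have lo0 s : 0 <= lo s by rewrite /lo le_max lexx.
have lo_up s : lo s <= up s.
  by rewrite /lo ge_max low_up andbT; case/andP: (dup.2 s).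
have clo : continuous lo.
  by move=> s; apply: continuous_max; [exact: cvg_cst|exact: continuous_comb].
have dlo : unit_profile lo.
  by apply: continuous_profile => // s; rewrite lo0 /lo ge_max ler01 low1.
exists up, lo, (A + (Y + B) + Cb + B), C1; split=> //; split=> //.
- move=> s; have [s0|s0] := lerP s 0; last first.
    have q1 : 1 <= q s ^+ 4 by rewrite exprn_ege1// q_ge1// ltW.
    have C0 : 1 <= A + (Y + B) + Cb + B by lra.
    apply: (@le_trans _ _ 1); last by rewrite mulr_ege1.
    by have := lo0 s; case/andP: (dup.2 s); lra.
  have h1 := upH s; have h2 := lo_low s.
  apply: (@le_trans _ _ (comb A 1 (- 1) Cb s - low s)); first lra.
  have -> : comb A 1 (- 1) Cb s - low s = q s ^+ 4 * (A + (Y + B) - q s ^+ 2 * (1 + B)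
     + (Cb + B) * q s ^+ 4) by rewrite combE lowE; ring.
  rewrite mulrC ler_pM2r//.
  have h3 : q s ^+ 4 <= 1 by rewrite exprn_ile1 ?(ltW (q0 _))// q_le1.
  have h4 : 0 <= q s ^+ 2 * (1 + B) by rewrite mulr_ge0 ?(ltW (qX0 _ _))//; lra.
  have : (Cb + B) * q s ^+ 4 <= (Cb + B) * 1 by rewrite ler_wpM2l//; lra.
  by lra.
- exists (- (Y + B)) => s sY; rewrite /lo lt_max; apply/orP; right.
  have s0 : s <= 0 by lra.
  rewrite lowE pmulr_rgt0//.
  have h3 : q s ^+ 4 <= q s ^+ 2 by rewrite ler_wiXn2l ?(ltW (q0 _))// q_le1.
  have : 0 <= B * (q s ^+ 2 - q s ^+ 4) by rewrite mulr_ge0 ?(ltW B0)// subr_ge0.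
  by lra.
move=> x; rewrite {1}/lo ge_max; apply/andP; split.
  by case/andP: (step01 hk c d0 ha x dlo dup).
have [xY|xY] := lerP (- Y) x.
  by apply: le_trans (low0 _ xY) _; case/andP: (step01 hk c d0 ha x dlo dup).
pose e s := low s - K * q s ^+ 6.
have tlow : tame low by exact: tame_comb.
have tKq : tame (fun s => K * q s ^+ 6) by exact/tameZ/tame_qX.
have te : tame e by exact: tameB.
apply: (@le_trans _ _ (lin e x)).
  rewrite /e (linB hk _ _ _ tlow tKq) (linZ hk _ _ _ _ (tame_qX _ _)) (lin_qX hk).
  rewrite /low (lin_comb hk mom_lam mean_lam) /expcomb.
  have := HY x (ltW xY); rewrite !le_min => /and3P[q1 _ qB].
  have h1 : B * eig 8 * q x ^+ 2 <= 1.
    have h2 : q x ^+ 2 <= (B * eig 8 + 1)^-1.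
      by apply: le_trans qB; rewrite expr2 ler_piMl ?(ltW (q0 _)).
    have : (B * eig 8 + 1) * q x ^+ 2 <= 1 by rewrite -ler_pdivlMl// mulr1.
    by have := qX0 x 2; lra.
  have h2 : B * eig 8 * q x ^+ 2 * q x ^+ 6 <= 1 * q x ^+ 6 by rewrite ler_pM2r.
  have h3 : B * eig 6 = B + (K * eig 6 + 1).
    by rewrite /B; field; rewrite subr_eq0 gt_eqF.
  have h4 : 0 <= B * q x ^+ 8 by rewrite mulr_ge0 ?(ltW B0) ?(ltW (qX0 _ _)).
  by rewrite h3; lra.
rewrite /linop -(kmeanZ hk _ (tame_comp_sub _ te)); apply: (kmean_le hk).
- by apply: tameZ; apply: tame_comp_sub.
- by apply: tame_comp_sub; exact: tame_grow.
move=> y; set s := x - c - y.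
have up0 t : 0 <= up t by case/andP: (dup.2 t).
apply: (le_trans _ (growth_lower d0 ha (lo0 s) (up0 (s - c)))).
rewrite ler_pM2l ?addr_gt0// /e lerB//.
rewrite /K -!mulrA ler_pM2l//.
have h1 : lo s <= C1 * q s ^+ 3 by apply: le_trans (lo_up s) (upq s).
have h2 : up (s - c) <= C1 * q s ^+ 3.
  apply: le_trans (upq _) _; rewrite ler_pM2l; last by lra.
  apply: lerXn2r; rewrite ?nnegrE ?(ltW (q0 _))// q_le//.
  by rewrite lerBlDr lerDl ltW.
have -> : (1 + a) * (C1 * (C1 * q s ^+ 6)) = (C1 * q s ^+ 3) * (C1 * q s ^+ 3 + a * (C1 * q s ^+ 3)) by ring.
apply: ler_pM => //; first by rewrite addr_ge0// mulr_ge0.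
by apply: lerD => //; rewrite ler_wpM2l.
Qed.

End Sandwich.

(** * Coupled monotone iteration *)

Section FixedPoint.
Variable R : realType.
Variable k : R -> R.
Hypothesis hk : dispersal_kernel k.
Variables (d a c : R).
Hypothesis d0 : 0 < d.
Hypothesis ha : 0 <= a < 1.
Hypothesis c0 : 0 < c.
Variable lam : R.
Hypothesis lam0 : 0 < lam.
Hypothesis mom_lam : (1 + d) * moment k lam = expR (lam * c).
Hypothesis mean_lam : kmean k (fun y => y * expR (lam * y)) = c * moment k lam.
Hypothesis eig6 : 1 < eigval k d c lam 6.

Notation q := (qexp lam).
Notation lin := (linop k d c).
Notation step := (wave_step k d a c).
Notation grow := (delay_growth d a c).

(** The gap [D] at [x] is controlled by [D] at [x - c - y] and at
    [x - 2 c - y].  Replacing [D] by its supremum [E] along steps of length [c]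
    to the left absorbs the delay, and [E] is a subsolution of the linear
    equation. *)
Lemma coupled_unique (pu pl : R -> R) (C0 : R) : unit_profile pu -> unit_profile pl ->
  (forall s, pl s <= pu s) -> (forall s, pu s - pl s <= C0 * q s ^+ 4) ->
  (forall x, pu x = step pu pl x) -> (forall x, pl x = step pl pu x) ->
  pu = pl.
Proof.
move=> du dl lu gap fu fl.
have l0 := lam0.
pose D s := pu s - pl s.
have D0 s : 0 <= D s by rewrite subr_ge0.
have D1 s : D s <= 1.
  by rewrite /D; case/andP: (du.2 s); case/andP: (dl.2 s); lra.
pose E s := sups (fun j => D (s - j%:R * c)) 0%N.
have hub s : has_ubound (range (fun j => D (s - j%:R * c))).
  by exists 1 => _ [j _ <-].
have EE s : E s = sup (range (fun j => D (s - j%:R * c))).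
  rewrite /E /sups /=; congr sup; apply/seteqP; split=> [_ [j _ <-]|_ [j _ <-]].
    by exists j.
  by exists j.
have DE s j : D (s - j%:R * c) <= E s.
  by rewrite EE; apply: ub_le_sup => //; exists j.
have DE0 s : D s <= E s by have := DE s 0%N; rewrite mul0r subr0.
have Ele s M : (forall j, D (s - j%:R * c) <= M) -> E s <= M.
  move=> H; rewrite EE; apply: ge_sup; first by exists (D (s - 0%:R * c)), 0%N.
  by move=> _ [j _ <-].
have EC s j : E (s - j%:R * c) <= E s.
  apply: Ele => i; have := DE s (i + j)%N.
  by rewrite natrD mulrDl opprD addrA addrAC.
have mD : measurable_fun setT D by apply: measurable_funB; [case: du|case: dl].
have mE : measurable_fun setT E.
  apply: measurable_fun_sups => // j; apply: measurableT_comp => //.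
  by apply: measurable_funB; [exact: measurable_id|exact: measurable_cst].
have dE : unit_profile E.
  split=> // s; rewrite (le_trans (D0 s) (DE0 s))/=.
  exact: Ele.
have tE := tame_profile dE.
have DL x : D x <= lin E x.
  rewrite /D fu fl /wave_step -(kmeanB hk); last 2 first.
  - by apply: tame_comp_sub; exact: tame_grow.
  - by apply: tame_comp_sub; exact: tame_grow.
  rewrite /linop -(kmeanZ hk _ (tame_comp_sub _ tE)); apply: (kmean_le hk).
  - by apply: tameB; apply: tame_comp_sub; exact: tame_grow.
  - by apply: tameZ; exact: tame_comp_sub.
  move=> y; set s := x - c - y; rewrite /delay_growth.
  apply: growth_diff => //.
  - by case/andP: (dl.2 s).
  - by case/andP: (dl.2 (s - c)).
  - exact: DE0.
  - by have := DE s 1%N; rewrite mul1r.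
have EL s : E s <= lin E s.
  apply: Ele => j; apply: (le_trans (DL _)); rewrite -lin_shift.
  by apply: (lin_le hk _ d0) => //; exact: tame_shift.
have E1 s : E s <= 1 by case/andP: (dE.2 s).
have Eq s : E s <= C0 * q s ^+ 4.
  apply: Ele => j; apply: (le_trans (gap _)).
  have C00 : 0 <= C0.
    have := le_trans (D0 0) (gap 0).
    by rewrite pmulr_lge0// exprn_gt0// q_gt0.
  rewrite ler_wpM2l//; apply: lerXn2r; rewrite ?nnegrE ?(ltW (q_gt0 _ _))// q_le//.
  by rewrite lerBlDr lerDl mulr_ge0// ltW.
have E0 := liouville hk d0 lam0 mom_lam mean_lam eig6 tE E1 Eq EL.
apply/funext => s; apply/eqP; rewrite -subr_eq0 eq_le D0 andbT.
exact: le_trans (DE0 s) (E0 s).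
Qed.

Variables (up lo : R -> R) (C0 : R).
Hypothesis dup : unit_profile up.
Hypothesis dlo : unit_profile lo.
Hypothesis cup : continuous up.
Hypothesis clo : continuous lo.
Hypothesis lo_up : forall s, lo s <= up s.
Hypothesis gap : forall s, up s - lo s <= C0 * q s ^+ 4.
Hypothesis step_up : forall v x, unit_profile v -> step up v x <= up x.
Hypothesis step_lo : forall x, lo x <= step lo up x.

Fixpoint iterates n : (R -> R) * (R -> R) :=
  if n is m.+1 then let p := iterates m in (step p.1 p.2, step p.2 p.1) else (up, lo).

Let U n := (iterates n).1.
Let L n := (iterates n).2.

Lemma iterates_prop n : [/\ unit_profile (U n), unit_profile (L n), continuous (U n),
  continuous (L n) & forall s, L n s <= U n s].
Proof.
elim: n => [|n [dU dL cU cL LU]]; first by split.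
split=> /=; try exact: profile_step; try exact: continuous_step.
by move=> s; apply: step_le.
Qed.

Lemma iterates_mono n : (forall s, U n.+1 s <= U n s) /\ (forall s, L n s <= L n.+1 s).
Proof.
elim: n => [|n [Un Ln]].
  by split=> s; [exact: step_up|exact: step_lo].
have [dU dL _ _ _] := iterates_prop n; have [dU' dL' _ _ _] := iterates_prop n.+1.
by split=> s; apply: step_le.
Qed.

(** The common limit of the two sequences is lower and upper semicontinuous. *)
Lemma fixed_point : exists phi, [/\ unit_profile phi, continuous phi,
  forall x, phi x = step phi phi x, forall x, phi x <= up x & forall x, lo x <= phi x].
Proof.
have Uni s : {homo (fun n => U n s) : m n / (m <= n)%N >-> n <= m}.
  by apply/nonincreasing_seqP => n; case: (iterates_mono n).
have Lnd s : {homo (fun n => L n s) : m n / (m <= n)%N >-> m <= n}.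
  by apply/nondecreasing_seqP => n; case: (iterates_mono n).
have U01 n s : 0 <= U n s <= 1 by have [[_ +] _ _ _ _] := iterates_prop n; apply.
have L01 n s : 0 <= L n s <= 1 by have [_ [_ +] _ _ _] := iterates_prop n; apply.
have cvU s : cvgn (fun n => U n s).
  apply: nonincreasing_is_cvgn; first exact: Uni.
  by exists 0 => _ [n _ <-]; case/andP: (U01 n s).
have cvL s : cvgn (fun n => L n s).
  apply: nondecreasing_is_cvgn; first exact: Lnd.
  by exists 1 => _ [n _ <-]; case/andP: (L01 n s).
pose pu s : R := limn (fun n => U n s); pose pl s : R := limn (fun n => L n s).
have puU n s : pu s <= U n s by apply: nonincreasing_cvgn_ge.
have plL n s : L n s <= pl s by apply: nondecreasing_cvgn_le.
have pu0 s : 0 <= pu s.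
  by apply: limr_ge => //; apply: nearW => n; case/andP: (U01 n s).
have plu s : pl s <= pu s.
  by apply: ler_lim => //; apply: nearW => n; case: (iterates_prop n).
have mU n : measurable_fun setT (U n) by have [[]] := iterates_prop n.
have mL n : measurable_fun setT (L n) by have [_ []] := iterates_prop n.
have dpu : unit_profile pu.
  split; first by apply: (@measurable_fun_cvg _ _ _ setT U) => // s _; exact: cvU.
  by move=> s; rewrite pu0 (le_trans (puU 0%N s))//; case/andP: (U01 0%N s).
have dpl : unit_profile pl.
  split; first by apply: (@measurable_fun_cvg _ _ _ setT L) => // s _; exact: cvL.
  move=> s; rewrite (le_trans _ (plL 0%N s)); last by case/andP: (L01 0%N s).
  by rewrite (le_trans (plu s))//; case/andP: (dpu.2 s).
have dU n : unit_profile (U n) by case: (iterates_prop n).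
have dL n : unit_profile (L n) by case: (iterates_prop n).
have fu x : pu x = step pu pl x.
  have h1 : step (U n) (L n) x @[n --> \oo] --> step pu pl x by exact: step_cvg.
  have h2 := cvU x; rewrite -(cvg_shiftS (fun n => U n x)) in h2.
  exact: cvg_unique h2 h1.
have fl x : pl x = step pl pu x.
  have h1 : step (L n) (U n) x @[n --> \oo] --> step pl pu x by exact: step_cvg.
  have h2 := cvL x; rewrite -(cvg_shiftS (fun n => L n x)) in h2.
  exact: cvg_unique h2 h1.
have pE : pu = pl.
  apply: (@coupled_unique _ _ C0) => // s.
  by apply: le_trans (gap s); have := puU 0%N s; have := plL 0%N s; rewrite /U /L /=; lra.
exists pu; split; first exact: dpu.
- move=> s; apply/cvgrPdist_lt => e e0.
  have e2 : 0 < e / 2 by rewrite divr_gt0.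
  have /cvgrPdist_lt /(_ _ e2) [N1 _ HU] := cvU s.
  have /cvgrPdist_lt /(_ _ e2) [N2 _ HL] := cvL s.
  have hU := HU N1 (leqnn _); have hL := HL N2 (leqnn _).
  have [_ _ cU _ _] := iterates_prop N1; have [_ _ _ cL _] := iterates_prop N2.
  near=> t.
  have h1 : `|U N1 s - U N1 t| < e / 2.
    by near: t; have /cvgrPdist_lt := cU s; apply.
  have h2 : `|L N2 s - L N2 t| < e / 2.
    by near: t; have /cvgrPdist_lt := cL s; apply.
  have h3 := puU N1 t; have h4 := plL N2 t.
  rewrite -/(pu s) in hU; rewrite -/(pl s) -pE in hL; rewrite -pE in h4.
  move: hU hL h1 h2; rewrite !ltr_distl => /andP[? ?] /andP[? ?] /andP[? ?] /andP[? ?].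
  by apply/andP; split; lra.
- by move=> x; rewrite {3}pE; exact: fu.
- by move=> x; exact: (puU 0%N).
- by move=> x; rewrite pE; exact: (plL 0%N).
Unshelve. all: by end_near. Qed.

End FixedPoint.

(** * A compactly supported bump *)

Section Bump.
Variable R : realType.

Definition bump (x : R) : R := (Num.max 0 (1 - x ^+ 2)) ^+ 2.

Lemma bump_ge0 x : 0 <= bump x. Proof. exact: sqr_ge0. Qed.

Lemma bump_le1 x : bump x <= 1.
Proof.
rewrite exprn_ile1 ?le_max ?lexx// ge_max ler01/=.
by have := sqr_ge0 x; lra.
Qed.

Lemma bump_outside x : 1 <= x ^+ 2 -> bump x = 0.
Proof. by move=> x1; rewrite /bump max_l ?expr0n//; lra. Qed.

(** The tangent line inequality for the convex function [t -> max (0, t) ^ 2]. *)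
Lemma sqr_max0_convex (s t : R) : 0 <= s ->
  s ^+ 2 + 2 * s * (t - s) <= Num.max 0 t ^+ 2.
Proof. 
move=> s0; have [t0|t0] := lerP t 0; last by have := sqr_ge0 (t - s); nra.
by nra.
Qed.

Let bump_sym_ge0 (x y : R) : 0 <= x -> 0 <= y ->
  2 * bump x * (1 - 8 * y ^+ 2) <= bump (x - y) + bump (x + y).
Proof.
move=> x0 y0.
have B1 := bump_ge0 (x - y); have B2 := bump_ge0 (x + y); have B0 := bump_ge0 x.
have [big|small] := leP 1 (8 * y ^+ 2).
  have : 0 <= bump x * (8 * y ^+ 2 - 1) by rewrite mulr_ge0//; lra.
  by lra.
have [out|inn] := leP 1 (x ^+ 2); first by rewrite (bump_outside out); lra.
set t := 1 - x ^+ 2; have t0 : 0 < t by rewrite /t; lra.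
have bx : bump x = t ^+ 2 by rewrite /bump max_r ?ltW.
have [t4|t4] := leP (1 / 4) t.
  have h1 := sqr_max0_convex (1 - (x - y) ^+ 2) (ltW t0).
  have h2 := sqr_max0_convex (1 - (x + y) ^+ 2) (ltW t0).
  rewrite -/(bump (x - y)) in h1; rewrite -/(bump (x + y)) in h2; rewrite bx.
  have h3 : 0 <= t * (y ^+ 2 * (4 * t - 1)).
    by rewrite mulr_ge0 ?(ltW t0)// mulr_ge0 ?sqr_ge0//; lra.
  have e1 : 1 - (x - y) ^+ 2 - t = 2 * x * y - y ^+ 2 by rewrite /t; ring.
  have e2 : 1 - (x + y) ^+ 2 - t = - (2 * x * y) - y ^+ 2 by rewrite /t; ring.
  rewrite e1 in h1; rewrite e2 in h2.
  have : 0 <= t * (t * (y ^+ 2)) by rewrite mulr_ge0 ?(ltW t0)// mulr_ge0 ?sqr_ge0 ?(ltW t0).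
  by lra.
have x2 : 3 / 4 < x ^+ 2 by rewrite /t in t4; lra.
suff : 2 * t ^+ 2 <= bump (x - y) + bump (x + y).
  rewrite bx => h; have : 0 <= t ^+ 2 * y ^+ 2 by rewrite mulr_ge0 ?sqr_ge0.
  by lra.
(* from [3 / 4 < x ^ 2] and [y ^ 2 < 1 / 8]; it yields
   [17 t / 12 <= T1] when [T2 <= 0], and [2 <= (17 / 12) ^ 2] *)
have yx : 17 * y <= 14 * x.
  rewrite leNgt; apply/negP => h.
  have : (14 * x) ^+ 2 < (17 * y) ^+ 2 by rewrite ltrXn2r// mulr_ge0.
  by rewrite !exprMn; lra.
pose T1 := 1 - (x - y) ^+ 2; pose T2 := 1 - (x + y) ^+ 2.
have w0 := sqr_ge0 y.
have e1 : T1 = t + (2 * x * y - y ^+ 2) by rewrite /T1 /t; ring.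
have e2 : T2 = t - (2 * x * y + y ^+ 2) by rewrite /T2 /t; ring.
have hxy : 17 * y ^+ 2 <= 7 * (2 * x * y).
  by have := ler_wpM2r y0 yx; lra.
have T1t : t <= T1 by rewrite e1; lra.
have b1 : bump (x - y) = T1 ^+ 2 by rewrite /bump max_r// -/T1; lra.
rewrite b1; have [T20|T20] := lerP T2 0.
  have h : 17 / 12 * t <= T1 by rewrite e1; lra.
  have : (17 / 12 * t) ^+ 2 <= T1 ^+ 2.
    by apply: lerXn2r; rewrite ?nnegrE//; lra.
  by rewrite exprMn; have := sqr_ge0 t; lra.
have b2 : bump (x + y) = T2 ^+ 2 by rewrite /bump max_r// -/T2 ltW.
rewrite b2 e1 e2.
have h1 : 0 <= y ^+ 2 * (4 * (x ^+ 2 - 3 / 4)) by rewrite mulr_ge0//; lra.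
have h2 : 0 <= y ^+ 2 * (1 / 4 - t) by rewrite mulr_ge0//; lra.
have : 0 <= (y ^+ 2) ^+ 2 by exact: sqr_ge0.
by lra.
Qed.

(** In the interior convexity of the square bounds the loss by a multiple of
    the height; near the edge the bump is convex enough to
    compensate for the mass that leaves it. *)
Lemma bump_sym (x y : R) : 2 * bump x * (1 - 8 * y ^+ 2) <= bump (x - y) + bump (x + y).
Proof.
have bN z : bump (- z) = bump z by rewrite /bump sqrrN.
have Sy u v : bump (u - - v) + bump (u + - v) = bump (u - v) + bump (u + v).
  by rewrite opprK addrC.
have Sx u v : bump (- u - v) + bump (- u + v) = bump (u - v) + bump (u + v).
  by rewrite -(bN (- u - v)) -(bN (- u + v)) addrC; congr (bump _ + bump _); ring.
have [x0|x0] := leP 0 x; have [y0|y0] := leP 0 y; first exact: bump_sym_ge0.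
- by rewrite -Sy -(sqrrN y); apply: bump_sym_ge0; rewrite // oppr_ge0 ltW.
- by rewrite -Sx -(bN x); apply: bump_sym_ge0; rewrite // oppr_ge0 ltW.
- by rewrite -Sx -Sy -(bN x) -(sqrrN y); apply: bump_sym_ge0; rewrite oppr_ge0 ltW.
Qed.

End Bump.

(** * Positivity and persistence *)

Section Wave.
Variable R : realType.
Variable k : R -> R.
Hypothesis hk : dispersal_kernel k.
Variables (d a c : R).
Hypothesis d0 : 0 < d.
Hypothesis ha : 0 <= a < 1.
Hypothesis c0 : 0 < c.
Variable phi : R -> R.
Hypothesis dphi : unit_profile phi.
Hypothesis cphi : continuous phi.
Hypothesis fphi : forall x, phi x = wave_step k d a c phi phi x.

Notation gr := (growth d a).
Notation grow := (delay_growth d a c).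
Let g := grow phi phi.
Let phi0 s : 0 <= phi s. Proof. by case/andP: (dphi.2 s). Qed.
Let phi1 s : phi s <= 1. Proof. by case/andP: (dphi.2 s). Qed.
Let tg x : tame (fun y => g (x - c - y)).
Proof. by apply: tame_comp_sub; exact: tame_grow. Qed.
Let phiE x : phi x = kmean k (fun y => g (x - c - y)). Proof. exact: fphi. Qed.

Lemma kmean_symmetrize (h : R -> R) : tame h ->
  2 * kmean k h = kmean k (fun y => h y + h (- y)).
Proof.
move=> th; rewrite (kmeanD hk th (tame_comp_oppr th)) (kmean_oppr hk th); ring.
Qed.

(** Positivity spreads to the right by [c] at each step: of the two points
    [s - c - y] and [s - c + y] one lies to the left of [s - c], and the kernel is
    even. *)
Lemma positivity : (exists s0, forall s, s < s0 -> 0 < phi s) -> forall s, 0 < phi s.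
Proof.
move=> [s0 H0].
have H n s : s < s0 + n%:R * c -> 0 < phi s.
  elim: n s => [|n IH] s; first by rewrite mul0r addr0; exact: H0.
  rewrite -natr1 mulrDl mul1r => hs.
  have g0 t : 0 <= g t by case/andP: (grow01 c d0 ha t dphi dphi).
  have gpos t : t < s0 + n%:R * c -> 0 < g t.
    by move=> ht; apply: growth_gt0 => //; exact: IH.
  suff : 0 < 2 * phi s by lra.
  rewrite phiE kmean_symmetrize//.
  have pos y : 0 < g (s - c - y) + g (s - c - - y).
    have [y0|y0] := leP 0 y.
      by rewrite ltr_wpDr// gpos//; lra.
    by rewrite ltr_wpDl// gpos//; lra.
  apply: (kmean_gt0 hk (p := 0)) => [|y|y _] //; last exact: ltW.
  by apply: tameD => //; exact: (tame_comp_oppr (tg s)).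
move=> s.
have [ss|ss] := ltP s s0; first exact: H0.
have /truncn_itv/andP[_] : 0 <= (s - s0) / c by rewrite divr_ge0 ?subr_ge0// ltW.
rewrite ltr_pdivrMr// => h; apply: (H (Num.truncn ((s - s0) / c)).+1); lra.
Qed.

Lemma tame_sqr : tame (fun y : R => y ^+ 2).
Proof.
by under eq_fun do rewrite expr2; apply: tameM; exact: tame_id.
Qed.

Lemma tame_bump (r : R) : tame (fun x => bump (x / r)).
Proof.
apply: (@tame_bounded _ _ 1).
  apply: measurable_funX; apply: measurable_maxr; first exact: measurable_cst.
  apply: measurable_funB; first exact: measurable_cst.
  by apply: measurable_funX; apply: measurable_funM.
by move=> y; rewrite ger0_norm ?bump_ge0// bump_le1.
Qed.

(** Averaging [bump_sym] over the kernel: a wide bump loses only a small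
    proportion of its height. *)
Lemma kmean_bump (r x : R) : 0 < r ->
  bump (x / r) * (1 - 8 * (kmean k (fun y => y ^+ 2) / r ^+ 2)) <=
  kmean k (fun y => bump ((x - y) / r)).
Proof.
move=> r0.
have tb : tame (fun y => bump ((x - y) / r)) by apply: (tame_comp_sub x (tame_bump r)).
suff : 2 * (bump (x / r) * (1 - 8 * (kmean k (fun y => y ^+ 2) / r ^+ 2))) <=
    2 * kmean k (fun y => bump ((x - y) / r)) by lra.
rewrite (kmean_symmetrize tb).
pose b := bump (x / r).
have te : tame (fun y => 2 * b + (- (16 * b / r ^+ 2)) * y ^+ 2).
  by apply: tameD; [exact: tame_cst|exact/tameZ/tame_sqr].
apply: (@le_trans _ _ (kmean k (fun y => 2 * b + (- (16 * b / r ^+ 2)) * y ^+ 2))).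
  rewrite (kmeanD hk (tame_cst (2 * b)) (tameZ _ tame_sqr)) (kmean_cst hk (2 * b)).
  rewrite (kmeanZ hk _ tame_sqr) -/b le_eqVlt; apply/orP; left; apply/eqP; ring.
apply: (kmean_le hk) => //; first by apply: tameD => //; exact: (tame_comp_oppr tb).
move=> y; have := bump_sym (x / r) (y / r).
rewrite opprK -mulrBl -mulrDl; apply: le_trans.
by rewrite -/b expr_div_n le_eqVlt; apply/orP; left; apply/eqP; ring.
Qed.

Hypothesis phi_pos : forall s, 0 < phi s.

(** In the rest frame the wave is a solution that starts above a small bump.  As
    the delayed term is at most [1], low densities grow at least by the factor
    [rho > 1], more than a wide bump loses by dispersal, so the bump persists for
    all later times; the wave at [x + c n] thus stays above it for every [n]. *)
Lemma persistence : exists2 del, 0 < del & forall s, 0 <= s -> del <= phi s.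
Proof.
have [a0 a1] := andP ha; have d0' := d0; have c0' := c0.
pose m2 := kmean k (fun y => y ^+ 2).
have m20 : 0 <= m2 by apply: (kmean_ge0 hk) => y; exact: sqr_ge0.
(* any height below [1 - a], the equilibrium facing a delayed term equal to [1] *)
pose e0 := (1 - a) / 2.
pose rho := (1 + d) / (1 + d * (e0 + a)).
have e00 : 0 < e0 by rewrite /e0; lra.
have den : 0 < 1 + d * (e0 + a) by rewrite addr_gt0// mulr_gt0// ltr_wpDr.
have rho1 : 1 < rho.
  by rewrite /rho ltr_pdivlMr// mul1r ltrD2l gtr_pMr// /e0; lra.
(* [2 c <= r] keeps [0 <= x <= c] in the inner half; the rest bounds the loss *)
pose r := 2 * c + 8 * m2 * rho / (rho - 1) + 1.
have rho0 : 0 <= rho by lra.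
have rr : 0 <= 8 * m2 * rho / (rho - 1).
  by apply: divr_ge0; [rewrite mulr_ge0// mulr_ge0|lra].
have r1 : 1 <= r by rewrite /r; lra.
have r0 : 0 < r by lra.
have rc : 2 * c <= r by rewrite /r; lra.
have rm : 1 <= rho * (1 - 8 * (m2 / r ^+ 2)).
  have h : 8 * m2 * rho <= (rho - 1) * r.
    rewrite (mulrC (rho - 1)) -ler_pdivrMr; last by lra.
    by rewrite /r; lra.
  have h2 : 8 * m2 * rho <= (rho - 1) * r ^+ 2.
    apply: (le_trans h); rewrite ler_pM2l; last by lra.
    by rewrite expr2 ler_peMr// ltW.
  have h3 : 8 * m2 * rho / r ^+ 2 <= rho - 1 by rewrite ler_pdivrMr ?exprn_gt0.
  have -> : rho * (1 - 8 * (m2 / r ^+ 2)) = rho - 8 * m2 * rho / r ^+ 2 by ring.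
  by lra.
have [xm xmi xmin] : exists2 t, t \in `[- r, r]%R & forall s, s \in `[- r, r]%R -> phi t <= phi s.
  by apply: EVT_min; [lra|exact: continuous_subspaceT].
pose e := Num.min e0 (phi xm).
have ep : 0 < e by rewrite lt_min phi_pos andbT.
have ee0 : e <= e0 by rewrite ge_min lexx.
have eb0 x : 0 <= e * bump x by rewrite mulr_ge0 ?(ltW ep)// bump_ge0.
have key n x : e * bump (x / r) <= phi (x + n%:R * c).
  elim: n x => [|n IH] x.
    rewrite mul0r addr0; have [xr|xr] := leP 1 ((x / r) ^+ 2).
      by rewrite bump_outside// mulr0.
    have xin : x \in `[- r, r]%R.
      have : `|x / r| < 1.
        rewrite ltNge; apply/negP => h; move: xr; apply/negP.
        by rewrite -leNgt -real_normK ?num_real// exprn_ege1.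
      by rewrite normrM normfV (gtr0_norm r0) ltr_pdivrMr// mul1r in_itv/= -ler_norml => /ltW.
    apply: (le_trans _ (xmin _ xin)).
    apply: (@le_trans _ _ e); last by rewrite ge_min lexx orbT.
    by rewrite ler_piMr ?bump_le1// ltW.
  have tb : tame (fun y => bump ((x - y) / r)) by apply: (tame_comp_sub x (tame_bump r)).
  rewrite phiE; apply: (@le_trans _ _ (kmean k (fun y => rho * e * bump ((x - y) / r)))).
    rewrite (kmeanZ hk _ tb) mulrC.
    have h := kmean_bump x r0.
    have h2 := ler_wpM2l (ltW (lt_trans ltr01 rho1)) h; rewrite -/m2 in h2.
    have h3 := ler_wpM2l (bump_ge0 (x / r)) rm.
    have h4 : bump (x / r) <= rho * kmean k (fun y => bump ((x - y) / r)) by lra.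
    by have := ler_wpM2r (ltW ep) h4; lra.
  apply: (kmean_le hk); [exact: tameZ|exact: tg|move=> y].
  have -> : x + n.+1%:R * c - c - y = (x - y) + n%:R * c by rewrite -natr1; ring.
  set b := bump ((x - y) / r).
  apply: (@le_trans _ _ (gr (e * b) 1)); last first.
    by apply: growth_le => //; [exact: eb0|exact: IH].
  have eb : e * b <= e0.
    by apply: le_trans ee0; rewrite ler_piMr ?bump_le1// ltW.
  have eb1 : 0 <= e * b := eb0 _.
  rewrite /growth mulr1.
  have -> : rho * e * b = (1 + d) * (e * b) / (1 + d * (e0 + a)) by rewrite /rho; ring.
  apply: ler_wpM2l; first by apply: mulr_ge0 => //; lra.
  rewrite lef_pV2 ?posrE//; first by rewrite lerD2l ler_pM2l// lerD2r.
  by rewrite ltr_pwDl// mulr_ge0 ?(ltW d0)// addr_ge0.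
exists (e / 4); first by lra.
move=> s s0.
have /truncn_itv : 0 <= s / c by rewrite divr_ge0// ltW.
set n := Num.truncn _; rewrite ler_pdivlMr// ltr_pdivrMr// -natr1 mulrDl mul1r => /andP[h1 h2].
have := key n (s - n%:R * c); rewrite subrK; apply: le_trans.
rewrite ler_pM2l//.
have x0 : 0 <= (s - n%:R * c) / r by rewrite divr_ge0 ?(ltW r0)//; lra.
have x1 : (s - n%:R * c) / r <= 1 / 2 by rewrite ler_pdivrMr//; lra.
set x := (s - _) / r in x0 x1 *.
have x2 : x ^+ 2 <= 1 / 4.
  have := ler_pM x0 x0 x1 x1; rewrite -expr2; lra.
rewrite /bump max_r; last by lra.
have x3 : 0 <= (1 - x ^+ 2 - 3 / 4) * (1 - x ^+ 2 + 3 / 4) by rewrite mulr_ge0//; lra.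
by lra.
Qed.

End Wave.

(** * Limits at infinity *)

Section Limits.
Variable R : realType.
Variable k : R -> R.
Hypothesis hk : dispersal_kernel k.
Variables (d a c : R).
Hypothesis d0 : 0 < d.
Hypothesis ha : 0 <= a < 1.
Hypothesis c0 : 0 < c.
Variable phi : R -> R.
Hypothesis dphi : unit_profile phi.
Hypothesis fphi : forall x, phi x = wave_step k d a c phi phi x.

Notation gr := (growth d a).
Notation grow := (delay_growth d a c).
Let g := grow phi phi.
Let phi0 s : 0 <= phi s. Proof. by case/andP: (dphi.2 s). Qed.
Let phi1 s : phi s <= 1. Proof. by case/andP: (dphi.2 s). Qed.
Let tg x : tame (fun y => g (x - c - y)).
Proof. by apply: tame_comp_sub; exact: tame_grow. Qed.
Let phiE x : phi x = kmean k (fun y => g (x - c - y)). Proof. exact: fphi. Qed.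
Let g01 s : 0 <= g s <= 1. Proof. exact: grow01. Qed.

Definition eventually_ge (m : R) := exists X, forall s, X <= s -> m <= phi s.
Definition eventually_le (M : R) := exists X, forall s, X <= s -> phi s <= M.

Let tail_small (e X : R) : 0 < e -> exists Y, forall x, Y <= x ->
  moment k 1 * expR (- (x - 2 * c - X)) <= e.
Proof.
move=> e0; have m1 := mom_ge1 hk 1.
exists (2 * c + X + moment k 1 / e) => x xY.
have h := expR_ge1Dx (x - 2 * c - X).
have h2 : moment k 1 / e <= expR (x - 2 * c - X) by lra.
rewrite expRN ler_pdivrMr ?expR_gt0//.
by rewrite ler_pdivrMr// mulrC in h2.
Qed.

Let te (z : R) : tame (fun y => expR (- z) * expR (1 * y)).
Proof. exact: tameZ (tame_expR 1). Qed.

Let cut (z y : R) : y <= z \/ 1 <= expR (- z) * expR (1 * y).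
Proof.
have [h|h] := leP y z; [by left|right].
by rewrite -expRD mul1r -expR0 ler_expR; lra.
Qed.

(** The arguments of the integrand lie in the region where the bounds hold, except
    for large [y]; that part is bounded by [exp (y - z)], whose mean decays. *)
Lemma improve_lower m M e : 0 <= m -> m <= 1 -> 0 <= M ->
  eventually_ge m -> eventually_le M -> 0 < e ->
  eventually_ge (gr m M - e).
Proof.
move=> m0 m1 M0 [X1 H1] [X2 H2] e0.
pose X := Num.max X1 X2; have c0' := c0.
have X1X : X1 <= X by rewrite le_max lexx.
have X2X : X2 <= X by rewrite le_max lexx orbT.
have [Y HY] := tail_small X e0; exists Y => x xY.
have := HY x xY; set z := x - 2 * c - X => hz.
rewrite phiE; apply: (@le_trans _ _ (gr m M - moment k 1 * expR (- z))); first by rewrite lerD2l lerN2.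
rewrite (mulrC (moment k 1)) -(kmeanZ hk _ (tame_expR 1)) -{1}(kmean_cst hk (gr m M)).
rewrite -(kmeanB hk (tame_cst _) (te z)).
apply: (kmean_le hk) => //; first by apply: tameB; [exact: tame_cst|exact: te].
move=> y /=; have [yz|h] := cut z y.
  have : gr m M <= g (x - c - y).
    apply: growth_le => //.
      by apply: H1; rewrite /z in yz; lra.
    by apply: H2; rewrite /z in yz; lra.
  by have := mulr_ge0 (expR_ge0 (- z)) (expR_ge0 (1 * y)); lra.
have : gr m M <= 1 by apply: growth_le1 => //; rewrite m0.
by have /andP[? ?] := g01 (x - c - y); lra.
Qed.

Lemma improve_upper m M e : 0 <= m -> 0 <= M ->
  eventually_ge m -> eventually_le M -> 0 < e ->
  eventually_le (gr M m + e).
Proof.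
move=> m0 M0 [X1 H1] [X2 H2] e0.
pose X := Num.max X1 X2; have c0' := c0.
have X1X : X1 <= X by rewrite le_max lexx.
have X2X : X2 <= X by rewrite le_max lexx orbT.
have [Y HY] := tail_small X e0; exists Y => x xY.
have := HY x xY; set z := x - 2 * c - X => hz.
rewrite phiE; apply: (@le_trans _ _ (gr M m + moment k 1 * expR (- z))); last by rewrite lerD2l.
rewrite (mulrC (moment k 1)) -(kmeanZ hk _ (tame_expR 1)) -{1}(kmean_cst hk (gr M m)).
rewrite -(kmeanD hk (tame_cst _) (te z)).
apply: (kmean_le hk) => //; first by apply: tameD; [exact: tame_cst|exact: te].
move=> y /=; have [yz|h] := cut z y.
  have : g (x - c - y) <= gr M m.
    apply: growth_le => //.
      by apply: H2; rewrite /z in yz; lra.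
    by apply: H1; rewrite /z in yz; lra.
  by have := mulr_ge0 (expR_ge0 (- z)) (expR_ge0 (1 * y)); lra.
have : 0 <= gr M m by apply: growth_ge0.
by have /andP[? ?] := g01 (x - c - y); lra.
Qed.

(** Passing to the best bounds [i <= s] gives [growth i s <= i] and
    [s <= growth s i], that is, [1 <= i + a s] and [s + a i <= 1], as [i > 0];
    since [a < 1], [i = s]. *)
Lemma limit_pinfty : (exists2 del, 0 < del & forall s, 0 <= s -> del <= phi s) ->
  phi xi @[xi --> +oo] --> (1 + a)^-1.
Proof.
move=> [del del0 Hdel]; have [a0 a1] := andP ha; have d0' := d0.
pose i := sup [set m | eventually_ge m]; pose s := inf [set M | eventually_le M].
have evd : eventually_ge del by exists 0.
have ev1 : eventually_le 1 by exists 0.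
have lu m M : eventually_ge m -> eventually_le M -> m <= M.
  move=> [X1 H1] [X2 H2]; apply: (le_trans (H1 (Num.max X1 X2) _)); first by rewrite le_max lexx.
  by apply: H2; rewrite le_max lexx orbT.
have si : has_sup [set m | eventually_ge m] by split; [exists del|exists 1 => m hm; exact: lu].
have hs : has_inf [set M | eventually_le M] by split; [exists 1|exists del => M hM; exact: lu].
have deli : del <= i by apply: ub_le_sup => //; case: si.
have i_s : i <= s.
  apply: ge_sup; first by case: si.
  by move=> m hm; apply: lb_le_inf; [case: hs|move=> M hM; exact: lu].
have s1 : s <= 1 by apply: ge_inf => //; case: hs.
have i0 : 0 < i by exact: lt_le_trans deli.
have evli t : 0 < t -> eventually_ge (i - t).
  move=> t0; have [m [X HX] hm] := sup_adherent t0 si.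
  by exists X => x xX; apply: le_trans (HX x xX); exact: ltW.
have evus t : 0 < t -> eventually_le (s + t).
  move=> t0; have [M [X HX] hM] := inf_adherent t0 hs.
  by exists X => x xX; apply: (le_trans (HX x xX)); exact: ltW.
have lower t : 0 < t -> t < i -> gr (i - t) (s + t) <= i.
  move=> t0 ti; apply/ler_addgt0Pr => e e0; rewrite -lerBlDr.
  apply: ub_le_sup; first by case: si.
  by apply: improve_lower => //; [lra|lra|lra|exact: evli|exact: evus].
have upper t : 0 < t -> t < i -> s <= gr (s + t) (i - t).
  move=> t0 ti; apply/ler_addgt0Pr => e e0.
  apply: ge_inf; first by case: hs.
  by apply: improve_upper => //; [lra|lra|exact: evli|exact: evus].
have eq1 : 1 <= i + a * s.
  suff : (1 + d) * i <= i * (1 + d * (i + a * s)).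
    rewrite mulrC ler_pM2l// lerD2l -{1}(mulr1 d) ler_pM2l//.
  apply/ler_addgt0Pr => e e0.
  pose t := Num.min (i / 2) (e / (1 + d)).
  have t0 : 0 < t by rewrite lt_min !divr_gt0//; lra.
  have ti : t < i by rewrite gt_min; apply/orP; left; lra.
  have te' : (1 + d) * t <= e by rewrite mulrC -ler_pdivlMr ?ge_min ?lexx ?orbT//; lra.
  have := lower t t0 ti; rewrite /growth ler_pdivrMr; last by apply: den_gt0 => //; lra.
  have : 0 <= d * (i * ((1 - a) * t)) by rewrite mulr_ge0 ?(ltW d0)// mulr_ge0 ?(ltW i0)// mulr_ge0 ?(ltW t0)//; lra.
  by lra.
have eq2 : s + a * i <= 1.
  have s0 : 0 < s by lra.
  suff : s * (1 + d * (s + a * i)) <= s * (1 + d).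
    by rewrite ler_pM2l// lerD2l -{2}(mulr1 d) ler_pM2l.
  apply/ler_addgt0Pr => e e0.
  pose t := Num.min (i / 2) (e / (1 + d)).
  have t0 : 0 < t by rewrite lt_min !divr_gt0//; lra.
  have ti : t < i by rewrite gt_min; apply/orP; left; lra.
  have te' : (1 + d) * t <= e by rewrite mulrC -ler_pdivlMr ?ge_min ?lexx ?orbT//; lra.
  have := upper t t0 ti; rewrite /growth ler_pdivlMr; last by apply: den_gt0 => //; lra.
  have : 0 <= d * (s * ((1 - a) * t)) by rewrite mulr_ge0 ?(ltW d0)// mulr_ge0 ?(ltW s0)// mulr_ge0 ?(ltW t0)//; lra.
  by lra.
have is' : s = i.
  apply/eqP; rewrite eq_le i_s andbT -subr_le0.
  by rewrite -(pmulr_rle0 _ (_ : 0 < 1 - a)); lra.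
have iE : i = (1 + a)^-1.
  have : i * (1 + a) = 1 by rewrite is' in eq1 eq2; lra.
  have n0 : 1 + a != 0 by rewrite gt_eqF//; lra.
  by move=> h; apply: (mulIf n0); rewrite h mulVf.
rewrite -iE; apply/cvgrPdist_le => e e0.
have [X1 H1] := evli e e0; have [X2 H2] := evus e e0.
exists (Num.max X1 X2); split; first exact: num_real.
move=> x; rewrite gt_max => /andP[/ltW x1 /ltW x2].
have h1 := H1 x x1; have h2 := H2 x x2; rewrite is' in h2.
by rewrite ler_distl; apply/andP; split; lra.
Qed.

Lemma limit_ninfty lam C1 : 0 < lam -> 0 < C1 -> (forall s, phi s <= C1 * qexp lam s ^+ 3) ->
  phi xi @[xi --> -oo] --> 0.
Proof.
move=> lam0 C10 H; apply/cvgrPdist_le => e e0.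
have m0 : 0 < Num.min 1 (e / C1) by rewrite lt_min ltr01 divr_gt0.
have [X [X0 HX]] := q_small lam0 m0.
exists (- X); split; first exact: num_real.
move=> x /ltW xX; have := HX x xX; rewrite le_min => /andP[q1 qe].
rewrite sub0r normrN ger0_norm//; apply: (le_trans (H x)).
rewrite mulrC -ler_pdivlMr//; apply: le_trans qe.
by rewrite exprS ler_piMr ?(ltW (q_gt0 _ _))// exprn_ile1 ?(ltW (q_gt0 _ _)).
Qed.

End Limits.

(** Near infinity the values are close to the limits, and a compact interval takes
    care of the rest. *)
Lemma cvg_infty_unif_continuous (R : realType) (f : R -> R) (l m : R) :
  continuous f -> f x @[x --> -oo] --> l -> f x @[x --> +oo] --> m ->
  unif_continuous f.
Proof.
move=> cf fl fm; apply/unif_continuousP => e e0.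
have e2 : 0 < e / 2 by rewrite divr_gt0.
have /cvgrPdist_lt /(_ _ e2) [A [_ HA]] := fl.
have /cvgrPdist_lt /(_ _ e2) [B [_ HB]] := fm.
pose P (t : R) (x : R) := forall y, `|x - y| < t -> `|f x - f y| < e.
have K : forall x, `[A - 1, B + 1]%classic x -> \forall x' \near x & t \near 0^'+, P t x'.
  move=> x _; have /cvgrPdist_lt /(_ _ e2) /nbhs_ballP [r /= r0 Hr] := cf x.
  exists (ball x (r / 2), [set t | t < r / 2]) => /=.
    by split; [apply: nbhsx_ballx; rewrite divr_gt0|apply: nbhs_right_lt; rewrite divr_gt0].
  move=> [x' t] [/= xx' tr] y yt.
  have h1 : `|f x - f x'| < e / 2.
    by apply: Hr; apply: le_ball xx'; rewrite ler_piMr ?ltW//; lra.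
  have h2 : `|f x - f y| < e / 2.
    apply: Hr; rewrite /ball/= in xx' *.
    rewrite (_ : x - y = (x - x') + (x' - y)); last by ring.
    by apply: (le_lt_trans (ler_normD _ _)); lra.
  rewrite (_ : f x' - f y = (f x - f y) - (f x - f x')); last by ring.
  by apply: (le_lt_trans (ler_normB _ _)); lra.
have H : \forall t \near 0^'+, `[A - 1, B + 1] `<=` P t.
  have /compact_near_coveringP := @segment_compact R (A - 1) (B + 1).
  by apply=> //; exact: K.
have [t [Ht t0]] : exists t, `[A - 1, B + 1] `<=` P t /\ 0 < t.
  near (0 : R)^'+ => t; exists t; split; last by near: t; exact: nbhs_right_gt.
  by near: t; exact: H.
exists (Num.min t 1); first by rewrite lt_min t0/= ltr01.
move=> [x y] /=; rewrite /ball/= lt_min => /andP[xyt xy1].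
have [xA|xA] := ltP x (A - 1).
  have yA : y < A by move: xy1; rewrite ltr_distl => /andP[? ?]; lra.
  have h1 := HA x (_ : x < A); have h2 := HA y yA.
  rewrite (_ : f x - f y = (l - f y) - (l - f x)); last by ring.
  by apply: (le_lt_trans (ler_normB _ _)); have := h1 (ltac:(lra)); rewrite /= in h2 *; lra.
have [xB|xB] := ltP (B + 1) x.
  have yB : B < y by move: xy1; rewrite ltr_distl => /andP[? ?]; lra.
  have h1 := HB x (_ : B < x); have h2 := HB y yB.
  rewrite (_ : f x - f y = (m - f y) - (m - f x)); last by ring.
  by apply: (le_lt_trans (ler_normB _ _)); have := h1 (ltac:(lra)); rewrite /= in h2 *; lra.
by apply: Ht => //=; rewrite in_itv/= xA xB.
Unshelve. all: by end_near. Qed.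

Unset Implicit Arguments.

Theorem theorem5p17 (R : realType) (k : R -> R) (hk : dispersal_kernel k)
    (d a : R) (hd : 0 < d) (ha : 0 <= a < 1) (c : R) (hc : c = cstar d k) :
  exists phi : R -> R,
    [/\ is_traveling_wave d a k c phi,
        forall xi : R, 0 < phi xi <= 1,
        phi xi @[xi --> -oo] --> 0 &
        phi xi @[xi --> +oo] --> (1 + a)^-1].
Proof.
have [lam lam0 rl] := critical_exponent hk hd.
have c0 : 0 < c by rewrite hc; exact: cstar_gt0 rl.
have mom_lam : (1 + d) * moment k lam = expR (lam * c) by rewrite hc; exact: critical_mom rl.
have mean_lam : kmean k (fun y => y * expR (lam * y)) = c * moment k lam.
  by rewrite hc; exact: kmean_id_expR rl.
have eig6 : 1 < eigval k d c lam 6.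
  have hl : lam / 2 != 0 by rewrite gt_eqF// divr_gt0.
  have := mom_gt_cstar hk hd lam0 rl hl; rewrite -hc /eigval.
  have -> : 6%:R * (lam / 4) = lam + lam / 2 by field.
  move=> /(_ (ltac:(by rewrite addr_gt0// divr_gt0))) h.
  by rewrite mulNr expRN ltr_pdivlMr ?expR_gt0// mul1r.
have [up [lo [C0 [C1 [[dup dlo cup clo lo_up] [upq gap lopos step_up step_lo]]]]]] :=
  sandwich hk hd ha c0 lam0 mom_lam mean_lam eig6.
have [phi [dphi cphi fphi phi_up lo_phi]] := fixed_point hk hd ha c0 lam0 mom_lam mean_lam
  eig6 dup dlo cup clo lo_up gap step_up step_lo.
have phi_pos : forall s, 0 < phi s.
  apply: (positivity hk hd ha c0 dphi fphi).
  by have [s0 H] := lopos; exists s0 => s /H; move/lt_le_trans; apply.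
have lim1 : phi xi @[xi --> +oo] --> (1 + a)^-1.
  apply: (limit_pinfty hk hd ha c0 dphi fphi).
  exact: (persistence hk hd ha c0 dphi cphi fphi phi_pos).
have lim0 : phi xi @[xi --> -oo] --> 0.
  apply: (@limit_ninfty _ _ _ lam (Num.max 1 C1)) => //.
    by rewrite lt_max ltr01.
  move=> s; apply: le_trans (phi_up s) _; apply: le_trans (upq s) _.
  apply: ler_wpM2r; last by rewrite le_max lexx orbT.
  by rewrite exprn_ge0// ltW// q_gt0.
exists phi; split=> //; last by move=> s; rewrite phi_pos; case/andP: (dphi.2 s).
split=> //.
- by exists 1; split=> // M M1 s _ /=; case/andP: (dphi.2 s) => ? ?; rewrite ger0_norm//; lra.
- exact: (cvg_infty_unif_continuous cphi lim0 lim1).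
move=> n x n0.
have E : (fun y => growth_integrand d a k (fun x => phi (x + c * n%:~R))
    (fun x => phi (x + c * (n - 1)%:~R)) x y) =
  (fun y => delay_growth d a c phi phi (x + c * (n + 1)%:~R - c - y) * k y).
  apply/funext => y; rewrite /growth_integrand /delay_growth /growth.
  have -> : x + c * (n + 1)%:~R - c - y = x - y + c * n%:~R by rewrite intrD; ring.
  have -> : x - y + c * n%:~R - c = x - y + c * (n - 1)%:~R by rewrite intrB; ring.
  by [].
split; last by rewrite E; exact: fphi.
have := tame_integrable hk (tame_comp_sub (x + c * (n + 1)%:~R - c) (tame_grow c hd ha dphi dphi)).
by rewrite -E.
Qed.
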